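(* Let $0<q<1$, $z_-<0<z_+$, and let $c,d$ be nonzero complex numbers such that none of $cz_-,cz_+,dz_-,dz_+$ lies in $q^{\mathbb Z}=\{q^k: k\in\mathbb Z\}$. Then for all $n,m\in\mathbb N$, $$\int_{\mathbb R_q} P_m(x)P_n(x)\frac{1}{(cx,dx;q)_\infty}\,d_qx=\delta_{mn}\,B(c,d;z_-,z_+)\,(q;q)_n\,(cd)^n q^{-n^2},$$ where $$B(c,d;z_-,z_+)=(1-q)z_+\frac{(q;q)_\infty\,\theta(z_-/z_+,\,cdz_-z_+;q)}{\theta(cz_-,dz_-,cz_+,dz_+;q)}.$$
   Context: $\mathbb N=\{0,1,2,\dots\}$. Notation: $(x;q)_n=\prod_{j=0}^{n-1}(1-xq^j)$, $(x;q)_\infty=\prod_{j\ge 0}(1-xq^j)$, $\theta(x;q)=(x;q)_\infty(q/x;q)_\infty$ for $x\ne0$; several arguments separated by commas denote a product, e.g. $(x,y;q)_\infty=(x;q)_\infty(y;q)_\infty$ and $\theta(x,y;q)=\theta(x;q)\theta(y;q)$. $\mathbb R_q=z_-q^{\mathbb Z}\cup z_+q^{\mathbb Z}$, and the Jackson $q$-integral is $$\int_{\mathbb R_q}f(x)\,d_qx=(1-q)\sum_{k=-\infty}^{\infty}\Big(f(z_+q^k)z_+q^k-f(z_-q^k)z_-q^k\Big)$$ for $f:\mathbb R_q\to\mathbb C$ for which the sum converges absolutely. For $n\in\mathbb N$ the polynomial $P_n$ (a multiple of an Al-Salam--Carlitz polynomial of type II) is $$P_n(x)=(-c)^nq^{-\frac12n(n-1)}\sum_{k=0}^{n}\frac{(q^{-n};q)_k(cx;q)_k}{(q;q)_k}(-1)^kq^{-\frac12k(k-1)}\Big(\frac{dq^n}{c}\Big)^k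 .$$ *)

(* Defs.v *)
From Stdlib Require Import Reals ZArith Arith.
From Coquelicot Require Import Coquelicot.
Open Scope C_scope.

Fixpoint qpoch (x : C) (q : R) (n : nat) : C :=
  match n with
  | O => 1
  | S m => qpoch x q m * (1 - x * RtoC (q ^ m))
  end.

(* Coquelicot's [Lim_seq] and [Series] are real-valued, so complex limits and
   sums are taken componentwise. *)
Definition Clim_seq (u : nat -> C) : C :=
  (real (Lim_seq (fun n => Re (u n))), real (Lim_seq (fun n => Im (u n)))).

Definition CSeries (a : nat -> C) : C :=
  (Series (fun n => Re (a n)), Series (fun n => Im (a n))).

Definition qpoch_inf (x : C) (q : R) : C := Clim_seq (qpoch x q).

Definition theta (x : C) (q : R) : C := qpoch_inf x q * qpoch_inf (RtoC q / x) q.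

(* A bilateral family is summed as (k >= 0) + (k <= -1); the value is
   meaningful only under [Zabs_summable]. *)
Definition Zneg_part (a : Z -> C) (n : nat) : C := a (- Z.of_nat (S n))%Z.
Definition Znonneg_part (a : Z -> C) (n : nat) : C := a (Z.of_nat n).

Definition Zabs_summable (a : Z -> C) : Prop :=
  ex_series (fun n => Cmod (Znonneg_part a n)) /\
  ex_series (fun n => Cmod (Zneg_part a n)).

Definition Zsum (a : Z -> C) : C :=
  CSeries (Znonneg_part a) + CSeries (Zneg_part a).

(* Only the values of [f] on z_- q^Z and z_+ q^Z matter. *)
Definition jackson_term (q zm zp : R) (f : R -> C) (k : Z) : C :=
  f (zp * powerRZ q k)%R * RtoC (zp * powerRZ q k)
  - f (zm * powerRZ q k)%R * RtoC (zm * powerRZ q k).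

Definition jackson_integrable (q zm zp : R) (f : R -> C) : Prop :=
  Zabs_summable (jackson_term q zm zp f).

Definition jackson_int (q zm zp : R) (f : R -> C) : C :=
  RtoC (1 - q) * Zsum (jackson_term q zm zp f).

(* The natural-number quotients [n * (n - 1) / 2] below are exact, also for
   n = 0 where the subtraction is truncated. *)
Definition ASC_P (q : R) (c d : C) (n : nat) (x : C) : C :=
  Cpow (- c) n * RtoC (/ q ^ (n * (n - 1) / 2)) *
  sum_n (fun k : nat =>
    qpoch (RtoC (/ q ^ n)) q k * qpoch (c * x) q k / qpoch (RtoC q) q k
    * Cpow (- (1)) k * RtoC (/ q ^ (k * (k - 1) / 2))
    * Cpow (d * RtoC (q ^ n) / c) k) n.

Definition ASC_weight (q : R) (c d : C) (x : C) : C :=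
  / (qpoch_inf (c * x) q * qpoch_inf (d * x) q).

Definition B (q : R) (c d : C) (zm zp : R) : C :=
  RtoC (1 - q) * RtoC zp *
  (qpoch_inf (RtoC q) q
   * (theta (RtoC zm / RtoC zp) q * theta (c * d * RtoC zm * RtoC zp) q))
  / (theta (c * RtoC zm) q * theta (d * RtoC zm) q
     * theta (c * RtoC zp) q * theta (d * RtoC zp) q).

Definition in_qZ (q : R) (x : C) : Prop := exists k : Z, x = RtoC (powerRZ q k).

Definition delta (m n : nat) : C := if Nat.eq_dec m n then 1 else 0.

(* Main.v *)
(** Let [J(za, zb; c, d)] be the one-sided Jackson integral from [zb] to [za] of
    [(qx/za, qx/zb; q)_oo / (cx, dx; q)_oo], whose numerator vanishes beyond the end points.
    Telescoping [(x/za, x/zb)_oo / (cx, dx)_oo] gives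
    [(1 - c za)(1 - c zb) J(c, d) = (1 - cd za zb) J(cq, d)]; iterating this lets [c -> 0],
    likewise [d -> 0], and expresses [J(c, d)] through [J(0, 0)], and [J(0, 0)] is found from
    [c = q/za], [d = q/zb], where the integrand is [1].  With [za = z_+ q^-M] and
    [zb = z_- q^-M] the numerator tends to [1] as [M -> oo], so that by dominated convergence
    [J] tends to the integral of the weight over [R_q], which is therefore [B(c, d)].

    Multiplying the weight by [(cx)_k (dx)_j] replaces [(c, d)] by [(c q^k, d q^j)], so all
    mixed moments follow from the quasi-periodicity of theta.  Integrating [P_n] against
    [(dx)_j] then gives the terminating q-binomial series of [(q^-j; q)_n], which vanishes
    for [j < n]; expanding [P_m] in the basis [(dx)_j] finishes the proof. *)
Require Import Defs.
From Stdlib Require Import Reals ZArith Lra Lia.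
From Coquelicot Require Import Coquelicot.
Open Scope C_scope.

(** * Limits and series of complex numbers *)

(** The theta functions appear only in the limit. With end points scaled by q^-M the closed form of
    J contains (cz q^-M; q)_oo, which grows without bound; its first M factors, read backwards, are
    (q/(cz); q)_M up to powers, so that (cz; q)_oo (q/(cz); q)_M emerges, a truncated theta(cz). The
    powers coming from one product of length 2M and from four products of length M cancel down to
    q^M, which is absorbed by the end point z_+ q^-M.

    The limit may be taken under the sum because, with the index counted from the end point, the
    numerator of the integrand is a bounded cutoff that does not depend on M.

    The opposite signs of z_- and z_+ enter in the evaluation of J(0, 0): the parameters q/za and
    q/zb create no pole on the lattice because zb/za is negative. Identities for J stay
    cross-multiplied until the limit has been taken, so that only the final division by theta values
    needs nonvanishing infinite products. *)

Definition Clim (u : nat -> C) (l : C) : Prop :=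
  is_lim_seq (fun n => Cmod (u n - l)) 0%R.

Lemma Csum_S (a : nat -> C) (n : nat) : sum_n a (S n) = sum_n a n + a (S n).
Proof. apply (sum_Sn a n). Qed.

Lemma Csum_O (a : nat -> C) : sum_n a 0 = a 0%nat.
Proof. apply (sum_O a). Qed.

Lemma Csum_ext (a b : nat -> C) (n : nat) :
  (forall k, a k = b k) -> sum_n a n = sum_n b n.
Proof. apply (sum_n_ext a b n). Qed.

Lemma is_lim_seq_squeeze0 (u v : nat -> R) :
  (forall n, 0 <= u n <= v n)%R -> is_lim_seq v 0%R -> is_lim_seq u 0%R.
Proof.
  intros H Hv.
  apply (is_lim_seq_le_le (fun _ => 0%R) u v 0%R H); auto.
  apply is_lim_seq_const.
Qed.

Lemma Clim_ext u v l : (forall n, u n = v n) -> Clim u l -> Clim v l.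
Proof.
  intros H. apply is_lim_seq_ext. intros n. now rewrite H.
Qed.

Lemma Clim_const l : Clim (fun _ => l) l.
Proof.
  apply is_lim_seq_ext with (fun _ => 0%R).
  - intros n. replace (l - l) with (RtoC 0) by ring. now rewrite Cmod_0.
  - apply is_lim_seq_const.
Qed.

Lemma Clim_plus u v a b : Clim u a -> Clim v b -> Clim (fun n => u n + v n) (a + b).
Proof.
  intros Hu Hv.
  apply is_lim_seq_squeeze0 with (fun n => Cmod (u n - a) + Cmod (v n - b))%R.
  - intros n; split; [apply Cmod_ge_0|].
    replace (u n + v n - (a + b)) with ((u n - a) + (v n - b)) by ring.
    apply Cmod_triangle.
  - replace 0%R with (0 + 0)%R by ring. now apply is_lim_seq_plus'.
Qed.

Lemma Clim_mult u v a b : Clim u a -> Clim v b -> Clim (fun n => u n * v n) (a * b).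
Proof.
  intros Hu Hv.
  apply is_lim_seq_squeeze0 with
    (fun n => Cmod (u n - a) * Cmod (v n - b)
              + (Cmod a * Cmod (v n - b) + Cmod b * Cmod (u n - a)))%R.
  - intros n; split; [apply Cmod_ge_0|].
    replace (u n * v n - a * b)
      with ((u n - a) * (v n - b) + (a * (v n - b) + b * (u n - a))) by ring.
    eapply Rle_trans; [apply Cmod_triangle|].
    rewrite Cmod_mult. apply Rplus_le_compat_l.
    eapply Rle_trans; [apply Cmod_triangle|].
    rewrite !Cmod_mult. lra.
  - replace 0%R with (0 * 0 + (Cmod a * 0 + Cmod b * 0))%R by ring.
    apply is_lim_seq_plus'; [|apply is_lim_seq_plus'];
      apply is_lim_seq_mult'; auto; apply is_lim_seq_const.
Qed.

Lemma Clim_opp u a : Clim u a -> Clim (fun n => - u n) (- a).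
Proof.
  intros H. apply is_lim_seq_ext with (2 := H). intros n.
  replace (- u n - - a) with (- (u n - a)) by ring. now rewrite Cmod_opp.
Qed.

Lemma Clim_minus u v a b : Clim u a -> Clim v b -> Clim (fun n => u n - v n) (a - b).
Proof. intros Hu Hv. apply Clim_plus; auto. now apply Clim_opp. Qed.

Lemma Clim_Cmod u a : Clim u a -> is_lim_seq (fun n => Cmod (u n)) (Cmod a).
Proof.
  intros H.
  apply is_lim_seq_ext with (fun n => (Cmod (u n) - Cmod a) + Cmod a)%R.
  { intros; ring. }
  replace (Finite (Cmod a)) with (Finite (0 + Cmod a)) by (f_equal; ring).
  apply is_lim_seq_plus'; [|apply is_lim_seq_const].
  apply is_lim_seq_abs_0.
  apply is_lim_seq_squeeze0 with (2 := H). intros n. split; [apply Rabs_pos|].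
  apply Rabs_le. split.
  - assert (T := Cmod_triangle (u n) (a - u n)).
    replace (u n + (a - u n)) with a in T by ring.
    replace (a - u n) with (- (u n - a)) in T by ring.
    rewrite Cmod_opp in T. lra.
  - assert (T := Cmod_triangle (u n - a) a).
    replace (u n - a + a) with (u n) in T by ring. lra.
Qed.

Lemma Clim_unique u a b : Clim u a -> Clim u b -> a = b.
Proof.
  intros Ha Hb.
  assert (H := Clim_Cmod _ _ (Clim_minus _ _ _ _ Ha Hb)).
  assert (E : Finite 0 = Finite (Cmod (a - b))).
  { rewrite <- (is_lim_seq_unique _ _ H). symmetry. apply is_lim_seq_unique.
    apply is_lim_seq_ext with (fun _ => 0%R); [|apply is_lim_seq_const].
    intros n. replace (u n - u n) with (RtoC 0) by ring. now rewrite Cmod_0. }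
  injection E as E. symmetry in E. apply Cmod_eq_0 in E.
  replace a with (a - b + b) by ring. rewrite E. ring.
Qed.

Lemma Clim_subseq u l (f : nat -> nat) :
  (forall n, (n <= f n)%nat) -> Clim u l -> Clim (fun n => u (f n)) l.
Proof.
  intros Hf Hu.
  apply (is_lim_seq_subseq (fun n => Cmod (u n - l)) _ f); auto.
  intros P [N HN]. exists N. intros n Hn. apply HN. specialize (Hf n). lia.
Qed.

Lemma Clim_le u l K : (forall n, Cmod (u n) <= K)%R -> Clim u l -> (Cmod l <= K)%R.
Proof.
  intros H Hu.
  apply (is_lim_seq_le (fun n => Cmod (u n)) (fun _ => K) (Cmod l) K H).
  - now apply Clim_Cmod.
  - apply is_lim_seq_const.
Qed.

Lemma Clim_incr u l (k : nat) : Clim (fun n => u (n + k)%nat) l -> Clim u l.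
Proof. intros H. apply (is_lim_seq_incr_n (fun n => Cmod (u n - l)) k). exact H. Qed.

Lemma Clim_Re u l : Clim u l -> is_lim_seq (fun n => Re (u n)) (Re l).
Proof.
  intros H. apply is_lim_seq_ext with (fun n => Re (u n - l) + Re l)%R.
  { intros n. destruct (u n), l; simpl; ring. }
  replace (Finite (Re l)) with (Finite (0 + Re l)) by (f_equal; ring).
  apply is_lim_seq_plus'; [|apply is_lim_seq_const].
  apply is_lim_seq_abs_0, is_lim_seq_squeeze0 with (2 := H).
  intros n. split; [apply Rabs_pos|apply re_le_Cmod].
Qed.

Lemma Clim_Im u l : Clim u l -> is_lim_seq (fun n => Im (u n)) (Im l).
Proof.
  intros H. apply is_lim_seq_ext with (fun n => Im (u n - l) + Im l)%R.
  { intros n. destruct (u n), l; simpl; ring. }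
  replace (Finite (Im l)) with (Finite (0 + Im l)) by (f_equal; ring).
  apply is_lim_seq_plus'; [|apply is_lim_seq_const].
  apply is_lim_seq_abs_0, is_lim_seq_squeeze0 with (2 := H).
  intros n. split; [apply Rabs_pos|].
  eapply Rle_trans; [|apply Rmax_Cmod]. apply Rmax_r.
Qed.

Lemma Clim_of_Re_Im u l :
  is_lim_seq (fun n => Re (u n)) (Re l) -> is_lim_seq (fun n => Im (u n)) (Im l) ->
  Clim u l.
Proof.
  intros Hr Hi.
  apply is_lim_seq_squeeze0 with
    (fun n => Rabs (Re (u n) - Re l) + Rabs (Im (u n) - Im l))%R.
  - intros n; split; [apply Cmod_ge_0|].
    replace (u n - l) with (RtoC (Re (u n) - Re l) + Ci * RtoC (Im (u n) - Im l)).
    2: { apply injective_projections; simpl; unfold Re, Im; ring. }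
    eapply Rle_trans; [apply Cmod_triangle|].
    rewrite Cmod_mult, Cmod_Ci, !Cmod_R. lra.
  - replace 0%R with (0 + 0)%R by ring.
    apply is_lim_seq_plus'; apply (proj1 (is_lim_seq_abs_0 _)).
    + replace 0%R with (Re l - Re l)%R by ring.
      apply is_lim_seq_minus'; auto; apply is_lim_seq_const.
    + replace 0%R with (Im l - Im l)%R by ring.
      apply is_lim_seq_minus'; auto; apply is_lim_seq_const.
Qed.

Lemma Clim_seq_eq u l : Clim u l -> Clim_seq u = l.
Proof.
  intros H. unfold Clim_seq.
  rewrite (is_lim_seq_unique _ _ (Clim_Re _ _ H)).
  rewrite (is_lim_seq_unique _ _ (Clim_Im _ _ H)).
  now destruct l.
Qed.

Lemma Re_sum_n (a : nat -> C) n : Re (sum_n a n) = sum_n (fun k => Re (a k)) n.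
Proof.
  induction n as [|n IH].
  - now rewrite Csum_O, sum_O.
  - rewrite Csum_S, sum_Sn, <- IH. reflexivity.
Qed.

Lemma Im_sum_n (a : nat -> C) n : Im (sum_n a n) = sum_n (fun k => Im (a k)) n.
Proof.
  induction n as [|n IH].
  - now rewrite Csum_O, sum_O.
  - rewrite Csum_S, sum_Sn, <- IH. reflexivity.
Qed.

Lemma CSeries_unique a l : Clim (sum_n a) l -> CSeries a = l.
Proof.
  intros H. unfold CSeries.
  rewrite (is_series_unique (fun n => Re (a n)) (Re l)).
  - rewrite (is_series_unique (fun n => Im (a n)) (Im l)); [now destruct l|].
    apply is_lim_seq_ext with (2 := Clim_Im _ _ H). intros n; apply Im_sum_n.
  - apply is_lim_seq_ext with (2 := Clim_Re _ _ H). intros n; apply Re_sum_n.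
Qed.

Definition Cabs_summable (a : nat -> C) : Prop := ex_series (fun n => Cmod (a n)).

Lemma Cabs_summable_le (a : nat -> C) (b : nat -> R) :
  (forall n, Cmod (a n) <= b n)%R -> ex_series b -> Cabs_summable a.
Proof.
  intros H Hb. apply (ex_series_le (K := R_AbsRing) (V := R_CompleteNormedModule)) with b; auto.
  intros n. change (norm (Cmod (a n))) with (Rabs (Cmod (a n))).
  rewrite Rabs_pos_eq; auto. apply Cmod_ge_0.
Qed.

Lemma CSeries_lim a : Cabs_summable a -> Clim (sum_n a) (CSeries a).
Proof.
  intros H.
  assert (E : forall f : nat -> R, (forall n, Rabs (f n) <= Cmod (a n))%R -> ex_series f).
  { intros f Hf.
    apply (ex_series_le (K := R_AbsRing) (V := R_CompleteNormedModule))
      with (fun n => Cmod (a n)); auto. }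
  apply Clim_of_Re_Im.
  - apply is_lim_seq_ext with (sum_n (fun k => Re (a k))).
    + intros n. now rewrite Re_sum_n.
    + apply Series_correct, E. intros; apply re_le_Cmod.
  - apply is_lim_seq_ext with (sum_n (fun k => Im (a k))).
    + intros n. now rewrite Im_sum_n.
    + apply Series_correct, E. intros.
      eapply Rle_trans; [|apply Rmax_Cmod]. apply Rmax_r.
Qed.

Lemma Cmod_sum_n (a : nat -> C) n : (Cmod (sum_n a n) <= sum_n (fun k => Cmod (a k)) n)%R.
Proof.
  induction n as [|n IH].
  - rewrite Csum_O, sum_O. lra.
  - rewrite Csum_S, sum_Sn. change plus with Rplus.
    eapply Rle_trans; [apply Cmod_triangle|]. lra.
Qed.

Lemma CSeries_Cmod a : Cabs_summable a -> (Cmod (CSeries a) <= Series (fun n => Cmod (a n)))%R.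
Proof.
  intros H.
  apply (is_lim_seq_le (fun n => Cmod (sum_n a n)) (sum_n (fun n => Cmod (a n)))
           (Cmod (CSeries a)) (Series (fun n => Cmod (a n)))).
  - intros; apply Cmod_sum_n.
  - now apply Clim_Cmod, CSeries_lim.
  - now apply Series_correct.
Qed.

Lemma CSeries_ext a b : (forall n, a n = b n) -> CSeries a = CSeries b.
Proof.
  intros H. unfold CSeries. f_equal; apply Series_ext; intros n; now rewrite H.
Qed.

Lemma Cabs_summable_ext a b : (forall n, a n = b n) -> Cabs_summable a -> Cabs_summable b.
Proof. intros H. apply ex_series_ext. intros n. now rewrite H. Qed.

Lemma sum_n_Cplus (a b : nat -> C) n :
  sum_n (fun k => a k + b k) n = sum_n a n + sum_n b n.
Proof. apply (sum_n_plus a b n). Qed.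

Lemma sum_n_Cmult_l (c : C) (a : nat -> C) n :
  sum_n (fun k => c * a k) n = c * sum_n a n.
Proof. apply (sum_n_mult_l (K := C_Ring) c a n). Qed.

Lemma Cabs_summable_plus a b :
  Cabs_summable a -> Cabs_summable b -> Cabs_summable (fun n => a n + b n).
Proof.
  intros Ha Hb. apply Cabs_summable_le with (fun n => Cmod (a n) + Cmod (b n))%R.
  - intros; apply Cmod_triangle.
  - apply (ex_series_plus (fun n => Cmod (a n)) (fun n => Cmod (b n))); auto.
Qed.

Lemma Cabs_summable_scal c a : Cabs_summable a -> Cabs_summable (fun n => c * a n).
Proof.
  intros Ha. apply Cabs_summable_le with (fun n => Cmod c * Cmod (a n))%R.
  - intros; rewrite Cmod_mult; lra.
  - apply (ex_series_scal (V := R_NormedModule) (Cmod c) (fun n => Cmod (a n))); auto.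
Qed.

Lemma CSeries_plus a b : Cabs_summable a -> Cabs_summable b ->
  CSeries (fun n => a n + b n) = CSeries a + CSeries b.
Proof.
  intros Ha Hb. apply CSeries_unique.
  apply Clim_ext with (fun n => sum_n a n + sum_n b n).
  - intros. symmetry; apply sum_n_Cplus.
  - apply Clim_plus; now apply CSeries_lim.
Qed.

Lemma CSeries_scal c a : Cabs_summable a -> CSeries (fun n => c * a n) = c * CSeries a.
Proof.
  intros Ha. apply CSeries_unique.
  apply Clim_ext with (fun n => c * sum_n a n).
  - intros. symmetry; apply sum_n_Cmult_l.
  - apply Clim_mult; [apply Clim_const|now apply CSeries_lim].
Qed.

Lemma CSeries_minus a b : Cabs_summable a -> Cabs_summable b ->
  CSeries (fun n => a n - b n) = CSeries a - CSeries b.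
Proof.
  intros Ha Hb.
  rewrite (CSeries_ext _ (fun n => a n + (-1) * b n)) by (intros; ring).
  rewrite CSeries_plus, CSeries_scal; auto; [ring|].
  now apply Cabs_summable_scal.
Qed.

(** * Dominated convergence for series *)

Lemma Series_tail_small (b : nat -> R) (eps : R) :
  ex_series b -> (0 < eps)%R ->
  exists N, (Rabs (Series (fun k => b (S N + k)%nat)) < eps)%R.
Proof.
  intros Hb He.
  assert (H : is_lim_seq (sum_n b) (Series b)) by now apply Series_correct.
  apply is_lim_seq_spec in H.
  destruct (H (mkposreal eps He)) as [N HN]. exists N.
  specialize (HN N (Nat.le_refl N)). simpl in HN.
  rewrite (Series_incr_n b (S N)) in HN; [|lia|auto]. simpl pred in HN.
  rewrite sum_n_Reals in HN.
  rewrite <- Rabs_Ropp. eapply Rle_lt_trans; [|exact HN].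
  right. f_equal. ring.
Qed.

(** Tannery's argument: beyond N the tail is at most that of [b], uniformly in [n], while the head
    is a finite sum of null sequences. *)
Lemma Series_dominated_0 (r : nat -> nat -> R) (b : nat -> R) :
  (forall n k, 0 <= r n k <= b k)%R -> ex_series b ->
  (forall k, is_lim_seq (fun n => r n k) 0%R) ->
  is_lim_seq (fun n => Series (r n)) 0%R.
Proof.
  intros Hr Hb Hl. apply is_lim_seq_spec. intros eps.
  destruct (Series_tail_small b (eps / 2)) as [N HN]; auto.
  { assert (T := cond_pos eps). lra. }
  assert (HS : is_lim_seq (fun n => sum_n (r n) N) 0%R).
  { clear HN. induction N as [|N IH].
    - apply is_lim_seq_ext with (2 := Hl 0%nat). intros n. now rewrite sum_O.
    - apply is_lim_seq_ext with (fun n => sum_n (r n) N + r n (S N))%R.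
      + intros n. now rewrite sum_Sn.
      + replace 0%R with (0 + 0)%R by ring. now apply is_lim_seq_plus'. }
  apply is_lim_seq_spec in HS.
  destruct (HS (mkposreal (eps / 2) ltac:(assert (T := cond_pos eps); lra))) as [M HM].
  exists M. intros n Hn. specialize (HM n Hn). simpl in HM.
  assert (Hex : ex_series (r n)).
  { apply (ex_series_le (K := R_AbsRing) (V := R_CompleteNormedModule)) with b; auto.
    intros k. change (norm (r n k)) with (Rabs (r n k)).
    rewrite Rabs_pos_eq; apply Hr. }
  rewrite (Series_incr_n (r n) (S N)); [|lia|auto]. simpl pred.
  rewrite sum_n_Reals in HM.
  assert (Hexb := proj1 (ex_series_incr_n b (S N)) Hb).
  assert (Hexr := proj1 (ex_series_incr_n (r n) (S N)) Hex).
  assert (T : (0 <= Series (fun k => r n (S N + k)%nat) <= Series (fun k => b (S N + k)%nat))%R).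
  { split.
    - rewrite <- (Rmult_0_l (Series (fun k => r n (S N + k)%nat))).
      rewrite <- Series_scal_l. apply Series_le; auto.
      intros k. assert (T := Hr n (S N + k)%nat). lra.
    - now apply Series_le. }
  apply Rabs_def2 in HN. apply Rabs_def2 in HM.
  apply Rabs_def1; lra.
Qed.

Lemma CSeries_dominated (a : nat -> nat -> C) (l : nat -> C) (b : nat -> R) :
  (forall n k, Cmod (a n k) <= b k)%R -> ex_series b ->
  (forall k, Clim (fun n => a n k) (l k)) ->
  Clim (fun n => CSeries (a n)) (CSeries l).
Proof.
  intros Ha Hb Hl.
  assert (Hlb : forall k, (Cmod (l k) <= b k)%R).
  { intros k. apply (Clim_le (fun n => a n k)); auto. }
  assert (Hd : forall n, Cabs_summable (fun k => a n k - l k)).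
  { intros n. apply Cabs_summable_le with (fun k => b k + b k)%R.
    - intros k. eapply Rle_trans; [apply Cmod_triangle|]. rewrite Cmod_opp.
      apply Rplus_le_compat; auto.
    - apply (ex_series_plus b b); auto. }
  apply is_lim_seq_squeeze0 with (fun n => Series (fun k => Cmod (a n k - l k))).
  - intros n. split; [apply Cmod_ge_0|].
    rewrite <- CSeries_minus.
    + apply CSeries_Cmod, Hd.
    + apply Cabs_summable_le with b; auto.
    + apply Cabs_summable_le with b; auto.
  - apply Series_dominated_0 with (fun k => b k + b k)%R.
    + intros n k. split; [apply Cmod_ge_0|].
      eapply Rle_trans; [apply Cmod_triangle|]. rewrite Cmod_opp.
      apply Rplus_le_compat; auto.
    + apply (ex_series_plus b b); auto.
    + exact Hl.
Qed.

(** * Infinite q-Pochhammer symbols *)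

Lemma RtoC_neq_0 (x : R) : x <> 0%R -> RtoC x <> 0.
Proof. intros H E. now apply H, RtoC_inj. Qed.

Lemma qpoch_S (x : C) (q : R) (n : nat) : qpoch x q (S n) = qpoch x q n * (1 - x * RtoC q ^ n).
Proof. simpl. now rewrite RtoC_pow. Qed.

Lemma qpoch_add (x : C) (q : R) (n m : nat) :
  qpoch x q (n + m) = qpoch x q n * qpoch (x * RtoC q ^ n) q m.
Proof.
  induction m as [|m IH].
  - rewrite Nat.add_0_r. simpl. ring.
  - rewrite Nat.add_succ_r, !qpoch_S, IH, Cpow_add_r. ring.
Qed.

Lemma qpoch_Sl (x : C) (q : R) (n : nat) : qpoch x q (S n) = (1 - x) * qpoch (x * RtoC q) q n.
Proof.
  change (S n) with (1 + n)%nat. rewrite qpoch_add, Cpow_1_r. simpl.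
  ring.
Qed.

Lemma Cmod_qpow (q : R) (n : nat) : (0 < q < 1)%R -> Cmod (RtoC q ^ n) = (q ^ n)%R.
Proof.
  intros hq. rewrite <- RtoC_pow, Cmod_R. apply Rabs_pos_eq, pow_le. lra.
Qed.

Lemma ex_series_qpow q : (0 < q < 1)%R -> ex_series (fun n => q ^ n)%R.
Proof. intros hq. apply ex_series_geom. rewrite Rabs_pos_eq; lra. Qed.

Lemma is_lim_seq_qpow q : (0 < q < 1)%R -> is_lim_seq (fun n => q ^ n)%R 0%R.
Proof. intros hq. apply is_lim_seq_geom. rewrite Rabs_pos_eq; lra. Qed.

Lemma Clim_qpow q : (0 < q < 1)%R -> Clim (fun n => RtoC q ^ n) 0.
Proof.
  intros hq. apply is_lim_seq_ext with (2 := is_lim_seq_qpow q hq).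
  intros n. replace (RtoC q ^ n - 0) with (RtoC q ^ n) by ring.
  now rewrite Cmod_qpow.
Qed.

Lemma sum_n_qpow_le q n : (0 < q < 1)%R -> (sum_n (fun k => q ^ k)%R n <= / (1 - q))%R.
Proof.
  intros hq. rewrite sum_n_Reals, tech3 by lra.
  unfold Rdiv. rewrite <- (Rmult_1_l (/ (1 - q))) at 2.
  apply Rmult_le_compat_r.
  - apply Rlt_le, Rinv_0_lt_compat. lra.
  - assert (0 < q ^ S n)%R by (apply pow_lt; lra). lra.
Qed.

Lemma qpoch_bound (x : C) (q : R) (n : nat) :
  (0 < q < 1)%R -> (Cmod (qpoch x q n) <= exp (Cmod x / (1 - q)))%R.
Proof.
  intros hq.
  (* The exponent carries the partial geometric sum, since the uniform bound alone does not survive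
     the induction; each factor is at most 1 + |x| q^n, hence at most exp(|x| q^n). *)
  assert (H : (Cmod (qpoch x q n) <= exp (Cmod x * ((1 - q ^ n) / (1 - q))))%R).
  { induction n as [|n IH].
    - simpl. rewrite Cmod_1. replace (Cmod x * ((1 - 1) / (1 - q)))%R with 0%R by (field; lra).
      rewrite exp_0. lra.
    - rewrite qpoch_S, Cmod_mult.
      replace (Cmod x * ((1 - q ^ S n) / (1 - q)))%R
        with (Cmod x * ((1 - q ^ n) / (1 - q)) + Cmod x * q ^ n)%R by (simpl; field; lra).
      rewrite exp_plus. apply Rmult_le_compat; try apply Cmod_ge_0; auto.
      eapply Rle_trans; [apply Cmod_triangle|].
      rewrite Cmod_opp, Cmod_1, Cmod_mult, Cmod_qpow by auto.
      apply exp_ineq1_le. }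
  eapply Rle_trans; [exact H|].
  assert (0 < q ^ n)%R by (apply pow_lt; lra).
  assert (0 < / (1 - q))%R by (apply Rinv_0_lt_compat; lra).
  assert (Hc := Cmod_ge_0 x).
  assert (E : (Cmod x * ((1 - q ^ n) / (1 - q)) <= Cmod x / (1 - q))%R).
  { unfold Rdiv. apply Rmult_le_compat_l; auto. nra. }
  destruct E as [E|E]; [left; now apply exp_increasing|right; now rewrite E].
Qed.

(** Turns the product into a telescoping series with terms of order q^k, so that convergence and the
    distance from 1 follow from series estimates, without logarithms. *)
Lemma sum_n_qpoch_diff (x : C) (q : R) (n : nat) :
  qpoch x q (S n) - 1 = sum_n (fun k => - (qpoch x q k * (x * RtoC q ^ k))) n.
Proof.
  induction n as [|n IH].
  - rewrite Csum_O, qpoch_S. simpl. ring.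
  - rewrite Csum_S, <- IH, (qpoch_S x q (S n)). ring.
Qed.

Lemma qpoch_diff_le (x : C) (q : R) (k : nat) : (0 < q < 1)%R ->
  (Cmod (- (qpoch x q k * (x * RtoC q ^ k)))
   <= exp (Cmod x / (1 - q)) * Cmod x * q ^ k)%R.
Proof.
  intros hq. rewrite Cmod_opp, !Cmod_mult, Cmod_qpow, Rmult_assoc by auto.
  apply Rmult_le_compat_r.
  - apply Rmult_le_pos; [apply Cmod_ge_0|apply pow_le; lra].
  - now apply qpoch_bound.
Qed.

Lemma qpoch_inf_lim (x : C) (q : R) : (0 < q < 1)%R -> Clim (qpoch x q) (qpoch_inf x q).
Proof.
  intros hq.
  set (a := fun k => - (qpoch x q k * (x * RtoC q ^ k))).
  assert (Ha : Cabs_summable a).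
  { apply Cabs_summable_le with (fun k => exp (Cmod x / (1 - q)) * Cmod x * q ^ k)%R.
    - intros k. now apply qpoch_diff_le.
    - apply (ex_series_scal (V := R_NormedModule)), ex_series_qpow; auto. }
  assert (H : Clim (qpoch x q) (CSeries a + 1)).
  { apply Clim_incr with 1%nat.
    apply Clim_ext with (fun n => sum_n a n + 1).
    - intros n. unfold a. rewrite <- sum_n_qpoch_diff, Nat.add_1_r. ring.
    - apply Clim_plus; [now apply CSeries_lim|apply Clim_const]. }
  unfold qpoch_inf. now rewrite (Clim_seq_eq _ _ H).
Qed.

Lemma qpoch_inf_split (x : C) (q : R) (n : nat) : (0 < q < 1)%R ->
  qpoch_inf x q = qpoch x q n * qpoch_inf (x * RtoC q ^ n) q.
Proof.
  intros hq. apply Clim_unique with (fun m => qpoch x q (n + m)).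
  - apply Clim_subseq with (f := fun m => (n + m)%nat); [lia|now apply qpoch_inf_lim].
  - apply Clim_ext with (fun m => qpoch x q n * qpoch (x * RtoC q ^ n) q m).
    + intros m. now rewrite qpoch_add.
    + apply Clim_mult; [apply Clim_const|now apply qpoch_inf_lim].
Qed.

Lemma qpoch_inf_shift (x : C) (q : R) : (0 < q < 1)%R ->
  qpoch_inf x q = (1 - x) * qpoch_inf (x * RtoC q) q.
Proof.
  intros hq. rewrite (qpoch_inf_split x q 1), Cpow_1_r by auto.
  simpl. ring.
Qed.

Lemma qpoch_inf_1 (q : R) : (0 < q < 1)%R -> qpoch_inf 1 q = 0.
Proof. intros hq. rewrite qpoch_inf_shift by auto. ring. Qed.

Lemma qpoch_inf_bound (x : C) (q : R) :
  (0 < q < 1)%R -> (Cmod (qpoch_inf x q) <= exp (Cmod x / (1 - q)))%R.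
Proof.
  intros hq. apply Clim_le with (2 := qpoch_inf_lim x q hq).
  intros n. now apply qpoch_bound.
Qed.

Lemma qpoch_inf_near_1 (x : C) (q : R) : (0 < q < 1)%R ->
  (Cmod (qpoch_inf x q - 1) <= exp (Cmod x / (1 - q)) / (1 - q) * Cmod x)%R.
Proof.
  intros hq.
  apply Clim_le with (fun n => qpoch x q (S n) - 1).
  - intros n. rewrite sum_n_qpoch_diff.
    eapply Rle_trans; [apply Cmod_sum_n|].
    apply Rle_trans with
      (sum_n (fun k => exp (Cmod x / (1 - q)) * Cmod x * q ^ k) n)%R.
    + apply sum_n_m_le. intros k. now apply qpoch_diff_le.
    + rewrite (sum_n_mult_l (K := R_Ring)). change mult with Rmult.
      replace (exp (Cmod x / (1 - q)) / (1 - q) * Cmod x)%R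
        with (exp (Cmod x / (1 - q)) * Cmod x * / (1 - q))%R by (field; lra).
      apply Rmult_le_compat_l; [|now apply sum_n_qpow_le].
      apply Rmult_le_pos; [left; apply exp_pos|apply Cmod_ge_0].
  - apply Clim_minus; [|apply Clim_const].
    apply Clim_subseq with (f := S); [lia|now apply qpoch_inf_lim].
Qed.

Lemma qpoch_inf_0 (q : R) : (0 < q < 1)%R -> qpoch_inf 0 q = 1.
Proof.
  intros hq. assert (H := qpoch_inf_near_1 0 q hq).
  rewrite Cmod_0, Rmult_0_r in H.
  replace (qpoch_inf 0 q) with ((qpoch_inf 0 q - 1) + 1) by ring.
  rewrite (Cmod_eq_0 (qpoch_inf 0 q - 1)); [ring|].
  assert (T := Cmod_ge_0 (qpoch_inf 0 q - 1)). lra.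
Qed.

Lemma Cmod_mult_qpow_le (x : C) (q : R) (n : nat) :
  (0 < q < 1)%R -> (Cmod (x * RtoC q ^ n) <= Cmod x)%R.
Proof.
  intros hq. rewrite Cmod_mult, Cmod_qpow by auto.
  rewrite <- (Rmult_1_r (Cmod x)) at 2.
  apply Rmult_le_compat_l; [apply Cmod_ge_0|].
  rewrite <- (pow1 n). apply pow_incr. lra.
Qed.

Lemma exp_le_mono x y : (x <= y)%R -> (exp x <= exp y)%R.
Proof. intros [H|H]; [left; now apply exp_increasing|right; now rewrite H]. Qed.

Lemma exp_qpow_le (x : C) (q : R) (n : nat) : (0 < q < 1)%R ->
  (exp (Cmod (x * RtoC q ^ n) / (1 - q)) <= exp (Cmod x / (1 - q)))%R.
Proof.
  intros hq. apply exp_le_mono, Rmult_le_compat_r.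
  - apply Rlt_le, Rinv_0_lt_compat. lra.
  - now apply Cmod_mult_qpow_le.
Qed.

Lemma qpoch_inf_qpow_bound (x : C) (q : R) (n : nat) : (0 < q < 1)%R ->
  (Cmod (qpoch_inf (x * RtoC q ^ n) q) <= exp (Cmod x / (1 - q)))%R.
Proof.
  intros hq. eapply Rle_trans; [now apply qpoch_inf_bound|now apply exp_qpow_le].
Qed.

Lemma qpoch_inf_qpow_lim (x : C) (q : R) : (0 < q < 1)%R ->
  Clim (fun n => qpoch_inf (x * RtoC q ^ n) q) 1.
Proof.
  intros hq.
  apply is_lim_seq_squeeze0 with
    (fun n => exp (Cmod x / (1 - q)) / (1 - q) * Cmod x * q ^ n)%R.
  - intros n. split; [apply Cmod_ge_0|].
    eapply Rle_trans; [now apply qpoch_inf_near_1|].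
    rewrite (Cmod_mult x), Cmod_qpow, Rmult_assoc by auto.
    apply Rmult_le_compat_r.
    + apply Rmult_le_pos; [apply Cmod_ge_0|apply pow_le; lra].
    + apply Rmult_le_compat_r; [apply Rlt_le, Rinv_0_lt_compat; lra|].
      rewrite <- (Cmod_qpow q n), <- Cmod_mult by auto. now apply exp_qpow_le.
  - replace (Finite 0) with (Finite (exp (Cmod x / (1 - q)) / (1 - q) * Cmod x * 0))
      by (f_equal; ring).
    apply is_lim_seq_mult'; [apply is_lim_seq_const|now apply is_lim_seq_qpow].
Qed.

(** The exact condition for (x; q)_oo to be nonzero. It is weaker than x lying outside q^Z: it
    survives multiplication by q^n but not division, which is why the lattice z q^Z needs the
    stronger [in_qZ] hypotheses. *)
Definition qregular (q : R) (x : C) : Prop := forall n, 1 - x * RtoC q ^ n <> 0.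

Lemma qpoch_neq_0 (x : C) (q : R) (n : nat) : qregular q x -> qpoch x q n <> 0.
Proof.
  intros H. induction n as [|n IH].
  - exact C1_nz.
  - rewrite qpoch_S. now apply Cmult_neq_0.
Qed.

(** The tail (x q^N; q)_oo tends to 1, so it is nonzero for some N; the N remaining factors are
    nonzero by regularity. *)
Lemma qpoch_inf_neq_0 (x : C) (q : R) : (0 < q < 1)%R -> qregular q x -> qpoch_inf x q <> 0.
Proof.
  intros hq H.
  assert (L := Clim_Cmod _ _ (qpoch_inf_qpow_lim x q hq)).
  rewrite Cmod_1 in L. apply is_lim_seq_spec in L.
  destruct (L (mkposreal 1 Rlt_0_1)) as [N HN].
  specialize (HN N (Nat.le_refl N)). simpl in HN. apply Rabs_def2 in HN.
  rewrite (qpoch_inf_split x q N) by auto.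
  apply Cmult_neq_0; [now apply qpoch_neq_0|].
  apply Cmod_gt_0. lra.
Qed.

Lemma qregular_qpow (x : C) (q : R) (n : nat) : qregular q x -> qregular q (x * RtoC q ^ n).
Proof.
  intros H m. specialize (H (n + m)%nat). rewrite Cpow_add_r in H.
  now rewrite <- Cmult_assoc.
Qed.

Lemma qregular_0 (q : R) : qregular q 0.
Proof. intros n. rewrite Cmult_0_l. replace (1 - 0) with (RtoC 1) by ring. apply C1_nz. Qed.

(** Rewrites the reciprocal with a denominator independent of [n], so that bounds uniform in [n] and
    the limit follow from those of the finite products. *)
Lemma inv_qpoch_inf_qpow (x : C) (q : R) (n : nat) : (0 < q < 1)%R -> qregular q x ->
  / qpoch_inf (x * RtoC q ^ n) q = qpoch x q n / qpoch_inf x q.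
Proof.
  intros hq H. rewrite (qpoch_inf_split x q n) by auto.
  field. split; [|now apply qpoch_neq_0].
  apply qpoch_inf_neq_0; auto. now apply qregular_qpow.
Qed.

Lemma inv_qpoch_inf_bound (x : C) (q : R) (n : nat) : (0 < q < 1)%R -> qregular q x ->
  (Cmod (/ qpoch_inf (x * RtoC q ^ n) q)
   <= exp (Cmod x / (1 - q)) / Cmod (qpoch_inf x q))%R.
Proof.
  intros hq H. assert (H0 := qpoch_inf_neq_0 x q hq H).
  rewrite inv_qpoch_inf_qpow, Cmod_div by auto.
  apply Rmult_le_compat_r; [|now apply qpoch_bound].
  apply Rlt_le, Rinv_0_lt_compat. now apply Cmod_gt_0.
Qed.

Lemma inv_qpoch_inf_lim (x : C) (q : R) : (0 < q < 1)%R -> qregular q x ->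
  Clim (fun n => / qpoch_inf (x * RtoC q ^ n) q) 1.
Proof.
  intros hq H.
  apply Clim_ext with (fun n => qpoch x q n * / qpoch_inf x q).
  - intros n. now rewrite inv_qpoch_inf_qpow.
  - replace (RtoC 1) with (qpoch_inf x q * / qpoch_inf x q).
    + apply Clim_mult; [now apply qpoch_inf_lim|apply Clim_const].
    + apply Cinv_r. now apply qpoch_inf_neq_0.
Qed.

(** * The one-sided integral *)

Lemma CSeries_telescope (u : nat -> C) l :
  Clim u l -> CSeries (fun n => u n - u (S n)) = u 0%nat - l.
Proof.
  intros H. apply CSeries_unique.
  apply Clim_ext with (fun n => u 0%nat - u (S n)).
  - intros n. induction n as [|n IH].
    + now rewrite Csum_O.
    + rewrite Csum_S, <- IH. ring.
  - apply Clim_minus; [apply Clim_const|].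
    apply Clim_subseq with (f := S); [lia|auto].
Qed.

Lemma Cmod_Cmult_le x y a b :
  (Cmod x <= a -> Cmod y <= b -> Cmod (x * y) <= a * b)%R.
Proof. intros. rewrite Cmod_mult. apply Rmult_le_compat; auto; apply Cmod_ge_0. Qed.

Definition jterm (q : R) (za zb c d z : C) (n : nat) : C :=
  let x := z * RtoC q ^ n in
  qpoch_inf (x * RtoC q / za) q * qpoch_inf (x * RtoC q / zb) q
  * (/ qpoch_inf (c * x) q * / qpoch_inf (d * x) q) * x.

(* [(1 - q) * jint] is the Jackson integral of [(qx/za, qx/zb)_oo / (cx, dx)_oo]
   from [zb] to [za]. *)
Definition jint (q : R) (za zb c d : C) : C :=
  CSeries (jterm q za zb c d za) - CSeries (jterm q za zb c d zb).

(** A q-primitive for the combination of integrands in [jboundary_diff]. It vanishes at x = za and x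
    = zb and tends to 1 at x = 0. *)
Definition jboundary (q : R) (za zb c d z : C) (n : nat) : C :=
  let x := z * RtoC q ^ n in
  qpoch_inf (x / za) q * qpoch_inf (x / zb) q
  * (/ qpoch_inf (c * x) q * / qpoch_inf (d * x) q).

Lemma jboundary_lim (q : R) (za zb c d z : C) : (0 < q < 1)%R ->
  qregular q (c * z) -> qregular q (d * z) ->
  Clim (jboundary q za zb c d z) 1.
Proof.
  intros hq hc hd.
  replace (RtoC 1) with (1 * 1 * (1 * 1)) by ring.
  apply Clim_ext with (fun n =>
    qpoch_inf (z / za * RtoC q ^ n) q * qpoch_inf (z / zb * RtoC q ^ n) q
    * (/ qpoch_inf (c * z * RtoC q ^ n) q * / qpoch_inf (d * z * RtoC q ^ n) q)).
  - intros n. unfold jboundary, Cdiv. repeat (f_equal; try ring).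
  - repeat apply Clim_mult; try apply qpoch_inf_qpow_lim; try apply inv_qpoch_inf_lim; auto.
Qed.

(** Once the common infinite products are removed, this is the polynomial identity c za zb ((1 -
    x/za)(1 - x/zb) - (1 - cx)(1 - dx)) = x ((1 - c za)(1 - c zb) - (1 - cd za zb)(1 - cx)). *)
Lemma jboundary_diff (q : R) (za zb c d z : C) (n : nat) : (0 < q < 1)%R -> za <> 0 -> zb <> 0 ->
  qregular q (c * z) -> qregular q (d * z) ->
  c * za * zb * (jboundary q za zb c d z n - jboundary q za zb c d z (S n))
  = (1 - c * za) * (1 - c * zb) * jterm q za zb c d z n
    - (1 - c * d * za * zb) * jterm q za zb (c * RtoC q) d z n.
Proof.
  intros hq ha hb hc hd. unfold jboundary, jterm. rewrite Cpow_S.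
  assert (Hc := hc n). assert (Hd := hd n).
  assert (Hc1 := qpoch_inf_neq_0 _ q hq (qregular_qpow _ _ (S n) hc)).
  assert (Hd1 := qpoch_inf_neq_0 _ q hq (qregular_qpow _ _ (S n) hd)).
  rewrite Cpow_S in Hc1, Hd1. set (x := z * RtoC q ^ n) in *.
  replace (z * (RtoC q * RtoC q ^ n)) with (x * RtoC q) by (unfold x; ring).
  replace (c * z * RtoC q ^ n) with (c * x) in Hc by (unfold x; ring).
  replace (d * z * RtoC q ^ n) with (d * x) in Hd by (unfold x; ring).
  replace (c * z * (RtoC q * RtoC q ^ n)) with (c * x * RtoC q) in Hc1 by (unfold x; ring).
  replace (d * z * (RtoC q * RtoC q ^ n)) with (d * x * RtoC q) in Hd1 by (unfold x; ring).
  replace (c * (x * RtoC q)) with (c * x * RtoC q) by ring.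
  replace (d * (x * RtoC q)) with (d * x * RtoC q) by ring.
  replace (c * RtoC q * x) with (c * x * RtoC q) by ring.
  rewrite (qpoch_inf_shift (x / za)), (qpoch_inf_shift (x / zb)),
    (qpoch_inf_shift (c * x)), (qpoch_inf_shift (d * x)) by auto.
  replace (x / za * RtoC q) with (x * RtoC q / za) by (unfold Cdiv; ring).
  replace (x / zb * RtoC q) with (x * RtoC q / zb) by (unfold Cdiv; ring).
  field. repeat split; auto.
Qed.

(** The bound is uniform in [N], so it gives summability (N = 0) and also the dominating series when
    c q^N tends to 0. *)
Lemma jterm_bound (q : R) (za zb c d z : C) (n N : nat) : (0 < q < 1)%R ->
  qregular q (c * z) -> qregular q (d * z) ->
  (Cmod (jterm q za zb (c * RtoC q ^ N) d z n) <=
   exp (Cmod (z * RtoC q / za) / (1 - q)) * exp (Cmod (z * RtoC q / zb) / (1 - q))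
   * ((exp (Cmod (c * z) / (1 - q)) / Cmod (qpoch_inf (c * z) q))
      * (exp (Cmod (d * z) / (1 - q)) / Cmod (qpoch_inf (d * z) q)))
   * Cmod z * q ^ n)%R.
Proof.
  intros hq hc hd. unfold jterm. rewrite (Rmult_assoc _ (Cmod z)).
  replace (z * RtoC q ^ n * RtoC q / za) with (z * RtoC q / za * RtoC q ^ n)
    by (unfold Cdiv; ring).
  replace (z * RtoC q ^ n * RtoC q / zb) with (z * RtoC q / zb * RtoC q ^ n)
    by (unfold Cdiv; ring).
  replace (c * RtoC q ^ N * (z * RtoC q ^ n)) with (c * z * RtoC q ^ (N + n))
    by (rewrite Cpow_add_r; ring).
  replace (d * (z * RtoC q ^ n)) with (d * z * RtoC q ^ n) by ring.
  repeat apply Cmod_Cmult_le; try apply qpoch_inf_qpow_bound;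
    try apply inv_qpoch_inf_bound; auto.
  - lra.
  - rewrite Cmod_qpow by auto. lra.
Qed.

Lemma jterm_summable (q : R) (za zb c d z : C) : (0 < q < 1)%R ->
  qregular q (c * z) -> qregular q (d * z) ->
  Cabs_summable (jterm q za zb c d z).
Proof.
  intros hq hc hd.
  eapply Cabs_summable_le.
  - intros n. assert (H := jterm_bound q za zb c d z n 0 hq hc hd).
    replace (c * RtoC q ^ 0) with c in H by (simpl; ring). exact H.
  - apply (ex_series_scal (V := R_NormedModule)). now apply ex_series_qpow.
Qed.

Lemma qregular_mult_qpow (q : R) (c z : C) (n : nat) :
  qregular q (c * z) -> qregular q (c * RtoC q ^ n * z).
Proof.
  intros H. replace (c * RtoC q ^ n * z) with (c * z * RtoC q ^ n) by ring.
  now apply qregular_qpow.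
Qed.

(** The right-hand side is the contribution of the point 0. It is the same for both end points, so
    it disappears in the difference that defines [jint]. *)
Lemma jseries_shift (q : R) (za zb c d z : C) : (0 < q < 1)%R -> za <> 0 -> zb <> 0 ->
  z = za \/ z = zb -> qregular q (c * z) -> qregular q (d * z) ->
  (1 - c * za) * (1 - c * zb) * CSeries (jterm q za zb c d z)
  - (1 - c * d * za * zb) * CSeries (jterm q za zb (c * RtoC q) d z)
  = - (c * za * zb).
Proof.
  intros hq ha hb hz hc hd.
  assert (hcq := qregular_mult_qpow q c z 1 hc). rewrite Cpow_1_r in hcq.
  assert (S1 := jterm_summable q za zb c d z hq hc hd).
  assert (S2 := jterm_summable q za zb (c * RtoC q) d z hq hcq hd).
  rewrite <- (CSeries_scal _ _ S1), <- (CSeries_scal _ _ S2), <- CSeries_minus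
    by now apply Cabs_summable_scal.
  set (u := fun n => c * za * zb * jboundary q za zb c d z n).
  rewrite (CSeries_ext _ (fun n => u n - u (S n))).
  - rewrite (CSeries_telescope u (c * za * zb * 1)).
    (* At an end point one of the numerator factors is (1; q)_oo = 0. *)
    + assert (E : jboundary q za zb c d z 0 = 0).
      { unfold jboundary. simpl. rewrite Cmult_1_r.
        destruct hz as [-> | ->].
        - replace (za / za) with (RtoC 1) by (field; auto).
          rewrite qpoch_inf_1 by auto. ring.
        - replace (zb / zb) with (RtoC 1) by (field; auto).
          rewrite qpoch_inf_1 by auto. ring. }
      unfold u. rewrite E. ring.
    + apply Clim_mult; [apply Clim_const|now apply jboundary_lim].
  - intros n. rewrite <- jboundary_diff by auto. unfold u. ring.
Qed.

Definition jregular (q : R) (za zb c : C) : Prop :=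
  qregular q (c * za) /\ qregular q (c * zb).

Lemma jregular_qpow (q : R) (za zb c : C) (n : nat) :
  jregular q za zb c -> jregular q za zb (c * RtoC q ^ n).
Proof. intros [H1 H2]. split; now apply qregular_mult_qpow. Qed.

Lemma jregular_0 (q : R) (za zb : C) : jregular q za zb 0.
Proof. split; rewrite Cmult_0_l; apply qregular_0. Qed.

Lemma jint_shift (q : R) (za zb c d : C) : (0 < q < 1)%R -> za <> 0 -> zb <> 0 ->
  jregular q za zb c -> jregular q za zb d ->
  (1 - c * za) * (1 - c * zb) * jint q za zb c d
  = (1 - c * d * za * zb) * jint q za zb (c * RtoC q) d.
Proof.
  intros hq ha hb [hca hcb] [hda hdb]. unfold jint.
  assert (E1 := jseries_shift q za zb c d za hq ha hb (or_introl eq_refl) hca hda).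
  assert (E2 := jseries_shift q za zb c d zb hq ha hb (or_intror eq_refl) hcb hdb).
  rewrite <- E2 in E1. apply Ceq_minus in E1. apply Ceq_minus.
  rewrite <- E1. ring.
Qed.

Lemma jint_shift_n (q : R) (za zb c d : C) (n : nat) : (0 < q < 1)%R -> za <> 0 -> zb <> 0 ->
  jregular q za zb c -> jregular q za zb d ->
  qpoch (c * za) q n * qpoch (c * zb) q n * jint q za zb c d
  = qpoch (c * d * za * zb) q n * jint q za zb (c * RtoC q ^ n) d.
Proof.
  intros hq ha hb hc hd. induction n as [|n IH].
  - simpl. rewrite (Cmult_1_r c). ring.
  - assert (E := jint_shift q za zb (c * RtoC q ^ n) d hq ha hb
                   (jregular_qpow _ _ _ _ n hc) hd).
    rewrite !qpoch_S.
    transitivity ((1 - c * RtoC q ^ n * za) * (1 - c * RtoC q ^ n * zb)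
      * (qpoch (c * za) q n * qpoch (c * zb) q n * jint q za zb c d)); [ring|].
    rewrite IH.
    transitivity (qpoch (c * d * za * zb) q n
      * ((1 - c * RtoC q ^ n * za) * (1 - c * RtoC q ^ n * zb)
         * jint q za zb (c * RtoC q ^ n) d)); [ring|].
    rewrite E, Cpow_S.
    replace (c * RtoC q ^ n * RtoC q) with (c * (RtoC q * RtoC q ^ n)) by ring.
    ring.
Qed.

Lemma jseries_lim_0 (q : R) (za zb c d z : C) : (0 < q < 1)%R ->
  qregular q (c * z) -> qregular q (d * z) ->
  Clim (fun N => CSeries (jterm q za zb (c * RtoC q ^ N) d z))
       (CSeries (jterm q za zb 0 d z)).
Proof.
  intros hq hc hd. eapply CSeries_dominated.
  - intros N n. now apply jterm_bound.
  - apply (ex_series_scal (V := R_NormedModule)). now apply ex_series_qpow.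
  - intros n. unfold jterm.
    repeat apply Clim_mult; try apply Clim_const.
    rewrite Cmult_0_l, qpoch_inf_0 by auto.
    replace (/ 1) with (RtoC 1) by (field; apply C1_nz).
    apply Clim_ext with (fun N => / qpoch_inf (c * z * RtoC q ^ n * RtoC q ^ N) q).
    + intros N. f_equal. f_equal. ring.
    + apply inv_qpoch_inf_lim; auto. now apply qregular_qpow.
Qed.

Lemma jint_reduce (q : R) (za zb c d : C) : (0 < q < 1)%R -> za <> 0 -> zb <> 0 ->
  jregular q za zb c -> jregular q za zb d ->
  qpoch_inf (c * za) q * qpoch_inf (c * zb) q * jint q za zb c d
  = qpoch_inf (c * d * za * zb) q * jint q za zb 0 d.
Proof.
  intros hq ha hb hc hd.
  apply Clim_unique with
    (fun n => qpoch (c * za) q n * qpoch (c * zb) q n * jint q za zb c d).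
  - repeat apply Clim_mult; try apply qpoch_inf_lim; auto. apply Clim_const.
  - apply Clim_ext with
      (fun n => qpoch (c * d * za * zb) q n * jint q za zb (c * RtoC q ^ n) d).
    + intros n. symmetry. now apply jint_shift_n.
    + apply Clim_mult; [now apply qpoch_inf_lim|].
      destruct hc, hd. apply Clim_minus; now apply jseries_lim_0.
Qed.

Lemma jint_comm (q : R) (za zb c d : C) : jint q za zb c d = jint q za zb d c.
Proof.
  assert (H : forall z n, jterm q za zb c d z n = jterm q za zb d c z n)
    by (intros; unfold jterm; ring).
  unfold jint. now rewrite (CSeries_ext _ _ (H za)), (CSeries_ext _ _ (H zb)).
Qed.

Lemma jint_reduce_00 (q : R) (za zb c d : C) : (0 < q < 1)%R -> za <> 0 -> zb <> 0 ->
  jregular q za zb c -> jregular q za zb d ->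
  qpoch_inf (c * za) q * qpoch_inf (c * zb) q
  * (qpoch_inf (d * za) q * qpoch_inf (d * zb) q) * jint q za zb c d
  = qpoch_inf (c * d * za * zb) q * jint q za zb 0 0.
Proof.
  intros hq ha hb hc hd.
  assert (E1 := jint_reduce q za zb c d hq ha hb hc hd).
  (* By symmetry the remaining parameter [d] is sent to 0 with the other one already 0, so the
     product gained here is (0; q)_oo = 1. *)
  assert (E2 := jint_reduce q za zb d 0 hq ha hb hd (jregular_0 q za zb)).
  replace (d * 0 * za * zb) with (RtoC 0) in E2 by ring.
  rewrite qpoch_inf_0, Cmult_1_l, (jint_comm q za zb d 0) in E2 by auto.
  rewrite <- E2.
  transitivity (qpoch_inf (d * za) q * qpoch_inf (d * zb) q
    * (qpoch_inf (c * za) q * qpoch_inf (c * zb) q * jint q za zb c d)); [ring|].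
  rewrite E1. ring.
Qed.

Lemma qregular_q (q : R) : (0 < q < 1)%R -> qregular q (RtoC q).
Proof.
  intros hq n. rewrite <- Cpow_S, <- RtoC_pow, <- RtoC_minus.
  apply RtoC_neq_0. assert (q ^ S n < 1)%R; [|lra].
  apply pow_lt_1_compat; [lra|lia].
Qed.

Lemma CSeries_qpow (q : R) (z : C) : (0 < q < 1)%R ->
  CSeries (fun n => z * RtoC q ^ n) = z / (1 - RtoC q).
Proof.
  intros hq.
  assert (H : 1 - RtoC q <> 0).
  { rewrite <- RtoC_minus. apply RtoC_neq_0. lra. }
  rewrite (CSeries_ext _ (fun n => z / (1 - RtoC q) * RtoC q ^ n
                                   - z / (1 - RtoC q) * RtoC q ^ S n)).
  - rewrite (CSeries_telescope (fun n => z / (1 - RtoC q) * RtoC q ^ n)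
               (z / (1 - RtoC q) * 0)).
    + simpl. ring.
    + apply Clim_mult; [apply Clim_const|now apply Clim_qpow].
  - intros n. rewrite Cpow_S. field. exact H.
Qed.

(* For [c = q/za] and [d = q/zb] the integrand is the constant [1]. *)
Lemma jint_00 (q : R) (za zb : C) : (0 < q < 1)%R -> za <> 0 -> zb <> 0 ->
  qregular q (RtoC q / za * zb) -> qregular q (RtoC q / zb * za) ->
  jint q za zb 0 0
  = za * (qpoch_inf (RtoC q) q * theta (zb / za) q).
Proof.
  intros hq ha hb hab hba.
  assert (Q1 := qregular_q q hq).
  assert (N1 : 1 - RtoC q <> 0) by (generalize (Q1 0%nat); simpl; now rewrite Cmult_1_r).
  assert (N2 := qpoch_inf_neq_0 _ q hq Q1).
  assert (Ea : RtoC q / za * za = RtoC q) by (field; auto).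
  assert (Eb : RtoC q / zb * zb = RtoC q) by (field; auto).
  assert (Ra : jregular q za zb (RtoC q / za)) by (split; auto; now rewrite Ea).
  assert (Rb : jregular q za zb (RtoC q / zb)) by (split; auto; now rewrite Eb).
  assert (E := jint_reduce_00 q za zb _ _ hq ha hb Ra Rb).
  replace (RtoC q / za * (RtoC q / zb) * za * zb) with (RtoC q * RtoC q) in E
    by (field; auto).
  rewrite Ea, Eb in E.
  assert (Eser : forall z, qregular q (RtoC q / za * z) -> qregular q (RtoC q / zb * z) ->
    CSeries (jterm q za zb (RtoC q / za) (RtoC q / zb) z) = z / (1 - RtoC q)).
  { intros z H1 H2. rewrite <- CSeries_qpow by auto. apply CSeries_ext. intros n.
    unfold jterm.
    assert (P1 := qpoch_inf_neq_0 _ q hq (qregular_qpow _ _ n H1)).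
    assert (P2 := qpoch_inf_neq_0 _ q hq (qregular_qpow _ _ n H2)).
    replace (z * RtoC q ^ n * RtoC q / za) with (RtoC q / za * z * RtoC q ^ n)
      by (field; auto).
    replace (z * RtoC q ^ n * RtoC q / zb) with (RtoC q / zb * z * RtoC q ^ n)
      by (field; auto).
    replace (RtoC q / za * (z * RtoC q ^ n)) with (RtoC q / za * z * RtoC q ^ n) by ring.
    replace (RtoC q / zb * (z * RtoC q ^ n)) with (RtoC q / zb * z * RtoC q ^ n) by ring.
    field. auto. }
  unfold jint at 1 in E. destruct Ra as [Ra1 Ra2], Rb as [Rb1 Rb2].
  rewrite !Eser in E by auto.
  assert (Es := qpoch_inf_shift (RtoC q) q hq).
  assert (N3 : qpoch_inf (RtoC q * RtoC q) q <> 0).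
  { intros H. apply N2. rewrite Es, H. ring. }
  (* The two geometric series give (za - zb)/(1 - q). Here za - zb = za (1 - zb/za) supplies the
     first factor of theta(zb/za), and 1 - q is absorbed by (q; q)_oo = (1 - q)(q^2; q)_oo. *)
  unfold theta. rewrite (qpoch_inf_shift (zb / za)) by auto.
  replace (zb / za * RtoC q) with (RtoC q / za * zb) by (field; auto).
  replace (RtoC q / (zb / za)) with (RtoC q / zb * za) by (field; auto).
  transitivity (/ qpoch_inf (RtoC q * RtoC q) q
    * (qpoch_inf (RtoC q * RtoC q) q * jint q za zb 0 0)); [field; auto|].
  rewrite <- E, Es. field. auto.
Qed.

(** * Bilateral sums *)

Lemma sum_n_Sl (a : nat -> C) (n : nat) :
  a 0%nat + sum_n (fun k => a (S k)) n = sum_n a (S n).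
Proof.
  induction n as [|n IH].
  - now rewrite Csum_S, !Csum_O.
  - rewrite (Csum_S a (S n)), <- IH, Csum_S. ring.
Qed.

Lemma Cabs_summable_S (a : nat -> C) :
  Cabs_summable a <-> Cabs_summable (fun n => a (S n)).
Proof. apply (ex_series_incr_1 (fun n => Cmod (a n))). Qed.

Lemma CSeries_S (a : nat -> C) :
  Cabs_summable a -> CSeries a = a 0%nat + CSeries (fun n => a (S n)).
Proof.
  intros H. symmetry.
  apply Clim_unique with (fun n => sum_n a (S n)).
  - apply Clim_ext with (fun n => a 0%nat + sum_n (fun k => a (S k)) n).
    + intros n. apply sum_n_Sl.
    + apply Clim_plus; [apply Clim_const|].
      apply CSeries_lim. now apply Cabs_summable_S in H.
  - apply Clim_subseq with (f := S); [lia|now apply CSeries_lim].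
Qed.

Lemma sum_n_single (v : C) (M n : nat) :
  (if (n <? M)%nat then RtoC 0 else v)
  = sum_n (fun k => if (k =? M)%nat then v else RtoC 0) n.
Proof.
  induction n as [|n IH].
  - rewrite Csum_O. now destruct M.
  - rewrite Csum_S, <- IH.
    destruct (Nat.ltb_spec n M), (Nat.ltb_spec (S n) M), (Nat.eqb_spec (S n) M);
      try lia; ring.
Qed.

Lemma Cabs_summable_single (v : C) (M : nat) :
  Cabs_summable (fun k => if (k =? M)%nat then v else RtoC 0).
Proof.
  revert v. induction M as [|M IH]; intros v; apply Cabs_summable_S; simpl.
  - apply Cabs_summable_le with (fun n => 0 * (/ 2) ^ n)%R.
    + intros n. rewrite Cmod_0. lra.
    + apply (ex_series_scal (V := R_NormedModule)), ex_series_geom. rewrite Rabs_pos_eq; lra.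
  - apply IH.
Qed.

Lemma CSeries_single (v : C) (M : nat) :
  CSeries (fun k => if (k =? M)%nat then v else RtoC 0) = v.
Proof.
  apply CSeries_unique, Clim_incr with M.
  apply Clim_ext with (fun _ => v); [|apply Clim_const].
  intros n. rewrite <- sum_n_single.
  now destruct (Nat.ltb_spec (n + M) M); [lia|].
Qed.

Lemma Cabs_summable_bounded_mult (chi a : nat -> C) (K : R) :
  (forall n, Cmod (chi n) <= K)%R -> Cabs_summable a ->
  Cabs_summable (fun n => chi n * a n).
Proof.
  intros H Ha. apply Cabs_summable_le with (fun n => K * Cmod (a n))%R.
  - intros n. rewrite Cmod_mult. apply Rmult_le_compat_r; [apply Cmod_ge_0|apply H].
  - now apply (ex_series_scal (V := R_NormedModule) K (fun n => Cmod (a n))).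
Qed.

Lemma Zabs_summable_shift (g : Z -> C) (M : nat) : Zabs_summable g ->
  Cabs_summable (fun n => g (Z.of_nat n - Z.of_nat M)%Z).
Proof.
  intros [H1 H2]. induction M as [|M IH].
  - apply Cabs_summable_ext with (2 := H1). intros n. unfold Znonneg_part. f_equal. lia.
  - apply Cabs_summable_S. apply Cabs_summable_ext with (2 := IH).
    intros n. f_equal. lia.
Qed.

(** Separates the nonnegative from the negative arguments of [g]. The finite negative part is padded
    with zeros to a full series, so that dominated convergence applies while M varies. *)
Lemma CSeries_cutoff (g : Z -> C) (chi : nat -> C) (K : R) (M : nat) :
  Zabs_summable g -> (forall n, Cmod (chi n) <= K)%R ->
  CSeries (fun n => chi n * g (Z.of_nat n - Z.of_nat M)%Z)
  = CSeries (fun n => chi (M + n)%nat * Znonneg_part g n)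
    + CSeries (fun n => (if (n <? M)%nat then chi (M - S n)%nat else 0) * Zneg_part g n).
Proof.
  intros Hg. revert chi. induction M as [|M IH]; intros chi Hchi.
  - rewrite (CSeries_unique (fun n => _ * Zneg_part g n) 0).
    + rewrite Cplus_0_r. apply CSeries_ext. intros n. unfold Znonneg_part.
      f_equal. f_equal. lia.
    + apply Clim_ext with (fun _ => RtoC 0); [|apply Clim_const].
      intros n. induction n as [|n IHn].
      * rewrite Csum_O. simpl. ring.
      * rewrite Csum_S, <- IHn. simpl. ring.
  - rewrite CSeries_S.
    2: { apply Cabs_summable_bounded_mult with K; auto. now apply Zabs_summable_shift. }
    rewrite (CSeries_ext (fun n => chi (S n) * _)
               (fun n => chi (S n) * g (Z.of_nat n - Z.of_nat M)%Z)).
    2: { intros n. do 2 f_equal. lia. }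
    rewrite (IH (fun n => chi (S n))) by auto.
    (* Passing from M to M + 1 adds one new lowest term, at argument -(M + 1); it is the entry of
       index M of [Zneg_part g] and is split off as a one-term series. *)
    rewrite (CSeries_ext (fun n => (if (n <? S M)%nat then _ else _) * _)
      (fun n => (if (n =? M)%nat then chi 0%nat * Zneg_part g M else 0)
                + (if (n <? M)%nat then chi (S (M - S n)) else 0) * Zneg_part g n)).
    + rewrite CSeries_plus, CSeries_single.
      * replace (Z.of_nat 0 - Z.of_nat (S M))%Z with (- Z.of_nat (S M))%Z by lia.
        unfold Zneg_part.
        change (fun n => chi (S M + n)%nat * Znonneg_part g n)
          with (fun n => chi (S (M + n)) * Znonneg_part g n).
        ring.
      * apply Cabs_summable_single.
      * apply Cabs_summable_bounded_mult with K; [|apply Hg].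
        intros n. destruct (n <? M)%nat; auto. rewrite Cmod_0.
        eapply Rle_trans; [apply Cmod_ge_0|apply (Hchi 0%nat)].
    + intros n.
      destruct (Nat.ltb_spec n M), (Nat.ltb_spec n (S M)), (Nat.eqb_spec n M);
        try lia; subst.
      * replace (S M - S n)%nat with (S (M - S n)) by lia. ring.
      * replace (S M - S M)%nat with 0%nat by lia. ring.
      * ring.
Qed.

Lemma Zsum_cutoff_lim (g : Z -> C) (chi : nat -> C) (K : R) :
  Zabs_summable g -> (forall n, Cmod (chi n) <= K)%R -> Clim chi 1 ->
  Clim (fun M => CSeries (fun n => chi n * g (Z.of_nat n - Z.of_nat M)%Z)) (Zsum g).
Proof.
  intros Hg Hchi Hl.
  assert (HK : (0 <= K)%R) by (eapply Rle_trans; [apply Cmod_ge_0|apply (Hchi 0%nat)]).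
  apply Clim_ext with (fun M =>
    CSeries (fun n => chi (M + n)%nat * Znonneg_part g n)
    + CSeries (fun n => (if (n <? M)%nat then chi (M - S n)%nat else 0) * Zneg_part g n)).
  { intros M. symmetry. now apply CSeries_cutoff with K. }
  unfold Zsum. destruct Hg as [H1 H2].
  apply Clim_plus.
  - apply CSeries_dominated with (fun n => K * Cmod (Znonneg_part g n))%R.
    + intros M n. apply Cmod_Cmult_le; auto. lra.
    + now apply (ex_series_scal (V := R_NormedModule) K (fun n => Cmod (Znonneg_part g n))).
    + intros n. rewrite <- (Cmult_1_l (Znonneg_part g n)) at 1.
      apply Clim_mult; [|apply Clim_const].
      apply Clim_subseq with (f := fun M => (M + n)%nat); [lia|auto].
  - apply CSeries_dominated with (fun n => K * Cmod (Zneg_part g n))%R.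
    + intros M n. apply Cmod_Cmult_le; [|lra].
      destruct (n <? M)%nat; auto. now rewrite Cmod_0.
    + now apply (ex_series_scal (V := R_NormedModule) K (fun n => Cmod (Zneg_part g n))).
    + intros n. rewrite <- (Cmult_1_l (Zneg_part g n)) at 1.
      apply Clim_mult; [|apply Clim_const].
      (* For M > n the test succeeds; starting at M = n + 1 removes it and turns the truncated
         subtraction into the plain index of [chi]. *)
      apply Clim_incr with (S n).
      apply Clim_ext with (2 := Hl). intros M.
      destruct (Nat.ltb_spec n (M + S n)); [|lia]. f_equal. lia.
Qed.

Lemma Zabs_summable_lin (a b : C) (g h : Z -> C) :
  Zabs_summable g -> Zabs_summable h -> Zabs_summable (fun k => a * g k + b * h k).
Proof.
  intros [G1 G2] [H1 H2].
  split; apply Cabs_summable_plus; now apply Cabs_summable_scal.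
Qed.

Lemma Zsum_lin (a b : C) (g h : Z -> C) :
  Zabs_summable g -> Zabs_summable h ->
  Zsum (fun k => a * g k + b * h k) = a * Zsum g + b * Zsum h.
Proof.
  intros [G1 G2] [H1 H2]. unfold Zsum.
  rewrite (CSeries_ext (Znonneg_part _)
    (fun n => a * Znonneg_part g n + b * Znonneg_part h n)) by reflexivity.
  rewrite (CSeries_ext (Zneg_part _)
    (fun n => a * Zneg_part g n + b * Zneg_part h n)) by reflexivity.
  rewrite !CSeries_plus, !CSeries_scal by (auto; now apply Cabs_summable_scal).
  ring.
Qed.

Lemma Zsum_ext (g h : Z -> C) : (forall k, g k = h k) -> Zsum g = Zsum h.
Proof. intros H. unfold Zsum. f_equal; apply CSeries_ext; intros n; apply H. Qed.

Lemma Zabs_summable_ext (g h : Z -> C) :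
  (forall k, g k = h k) -> Zabs_summable g -> Zabs_summable h.
Proof.
  intros H [H1 H2].
  split; [apply Cabs_summable_ext with (2 := H1)|apply Cabs_summable_ext with (2 := H2)];
    intros n; apply H.
Qed.

(** * Summability of the weight *)

Lemma powerRZ_add_nat (q : R) (k : Z) (n : nat) : (0 < q < 1)%R ->
  RtoC (powerRZ q (k + Z.of_nat n)) = RtoC (powerRZ q k) * RtoC q ^ n.
Proof.
  intros hq. rewrite powerRZ_add, <- pow_powerRZ, RtoC_mult, RtoC_pow by lra. reflexivity.
Qed.

Lemma powerRZ_sub_nat (q : R) (k : Z) (n : nat) : (0 < q < 1)%R ->
  RtoC (powerRZ q (k - Z.of_nat n)) = RtoC (powerRZ q k) / RtoC q ^ n.
Proof.
  intros hq. rewrite <- (Z.sub_add (Z.of_nat n) k) at 2.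
  rewrite powerRZ_add_nat by auto. field. apply Cpow_nz, RtoC_neq_0. lra.
Qed.

Lemma qregular_powerRZ (q : R) (y : C) (k : Z) : (0 < q < 1)%R ->
  ~ in_qZ q y -> qregular q (y * RtoC (powerRZ q k)).
Proof.
  intros hq H n E. apply H. exists (- (k + Z.of_nat n))%Z.
  rewrite <- Cmult_assoc, <- powerRZ_add_nat in E by auto.
  assert (E1 : y * RtoC (powerRZ q (k + Z.of_nat n)) = 1).
  { symmetry. now apply Ceq_minus. }
  rewrite <- (Cmult_1_l (RtoC (powerRZ q (- _)))), <- E1, <- Cmult_assoc, <- RtoC_mult,
    <- powerRZ_add by lra.
  rewrite Z.add_opp_diag_r. simpl. ring.
Qed.

Lemma qregular_not_in_qZ (q : R) (y : C) : (0 < q < 1)%R ->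
  ~ in_qZ q y -> qregular q y.
Proof.
  intros hq H. rewrite <- (Cmult_1_r y). now apply (qregular_powerRZ q y 0).
Qed.

Lemma in_qZ_mult_qpow (q : R) (y : C) (n : nat) : (0 < q < 1)%R ->
  ~ in_qZ q y -> ~ in_qZ q (y * RtoC q ^ n).
Proof.
  intros hq H [k Hk]. apply H. exists (k - Z.of_nat n)%Z.
  rewrite powerRZ_sub_nat, <- Hk by auto. field. apply Cpow_nz, RtoC_neq_0. lra.
Qed.

Definition wterm (q : R) (c d : C) (z : R) (k : Z) : C :=
  ASC_weight q c d (RtoC (z * powerRZ q k)) * RtoC (z * powerRZ q k).

Lemma ASC_weight_factor (q : R) (c d x : C) :
  qpoch_inf (c * x) q <> 0 -> qpoch_inf (d * x) q <> 0 ->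
  ASC_weight q c d x = / qpoch_inf (c * x) q * / qpoch_inf (d * x) q.
Proof. intros H1 H2. unfold ASC_weight. field. auto. Qed.

Lemma ASC_weight_qshift (q : R) (c d x : C) : (0 < q < 1)%R ->
  qregular q (c * x) -> qregular q (d * x) ->
  ASC_weight q c d (x * RtoC q) = (1 - c * x) * (1 - d * x) * ASC_weight q c d x.
Proof.
  intros hq hc hd. unfold ASC_weight.
  assert (H1 := qpoch_inf_neq_0 _ q hq hc).
  assert (H2 := qpoch_inf_neq_0 _ q hq hd).
  rewrite (qpoch_inf_shift (c * x)) in * by auto.
  rewrite (qpoch_inf_shift (d * x)) in * by auto.
  replace (c * x * RtoC q) with (c * (x * RtoC q)) in * by ring.
  replace (d * x * RtoC q) with (d * (x * RtoC q)) in * by ring.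
  assert (forall a b : C, a * b <> 0 -> a <> 0 /\ b <> 0) as Hm.
  { intros a b H. split; intros E; apply H; rewrite E; ring. }
  destruct (Hm _ _ H1), (Hm _ _ H2). field. auto.
Qed.

Lemma qregular_wterm (q : R) (c : C) (z : R) (k : Z) : (0 < q < 1)%R ->
  ~ in_qZ q (c * RtoC z) -> qregular q (c * RtoC (z * powerRZ q k)).
Proof. intros hq H. rewrite RtoC_mult, Cmult_assoc. now apply qregular_powerRZ. Qed.

Lemma wterm_nat (q : R) (c d : C) (z : R) (n : nat) : (0 < q < 1)%R ->
  ~ in_qZ q (c * RtoC z) -> ~ in_qZ q (d * RtoC z) ->
  wterm q c d z (Z.of_nat n)
  = / qpoch_inf (c * RtoC z * RtoC q ^ n) q * / qpoch_inf (d * RtoC z * RtoC q ^ n) q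
    * (RtoC z * RtoC q ^ n).
Proof.
  intros hq hc hd. unfold wterm.
  rewrite ASC_weight_factor by (apply qpoch_inf_neq_0; auto; now apply qregular_wterm).
  rewrite <- pow_powerRZ, RtoC_mult, RtoC_pow, !Cmult_assoc. reflexivity.
Qed.

Lemma wterm_pred (q : R) (c d : C) (z : R) (n : nat) : (0 < q < 1)%R ->
  ~ in_qZ q (c * RtoC z) -> ~ in_qZ q (d * RtoC z) ->
  Zneg_part (wterm q c d z) n
  = (1 - c * RtoC z / RtoC q ^ S (S n)) * (1 - d * RtoC z / RtoC q ^ S (S n)) * RtoC q
    * Zneg_part (wterm q c d z) (S n).
Proof.
  intros hq hc hd. unfold Zneg_part, wterm.
  (* Entry [S n] of the negative part sits at x = z q^-(n+2), and entry [n] at x q; hence the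
     exponent [S (S n)]. *)
  set (x := RtoC (z * powerRZ q (- Z.of_nat (S (S n))))).
  assert (Ex : x = RtoC z / RtoC q ^ S (S n)).
  { unfold x. rewrite <- Z.sub_0_l, RtoC_mult, powerRZ_sub_nat by auto.
    simpl powerRZ. field. apply Cpow_nz, RtoC_neq_0. lra. }
  assert (Ex1 : RtoC (z * powerRZ q (- Z.of_nat (S n))) = x * RtoC q).
  { unfold x. rewrite !RtoC_mult.
    replace (- Z.of_nat (S n))%Z with (- Z.of_nat (S (S n)) + Z.of_nat 1)%Z by lia.
    rewrite powerRZ_add_nat, Cpow_1_r by auto. ring. }
  rewrite Ex1, ASC_weight_qshift by (auto; now apply qregular_wterm).
  rewrite Ex. unfold Cdiv. ring.
Qed.

(** The ratio test for the negative part divides by consecutive terms. *)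
Lemma wterm_neq_0 (q : R) (c d : C) (z : R) (k : Z) : (0 < q < 1)%R -> z <> 0%R ->
  ~ in_qZ q (c * RtoC z) -> ~ in_qZ q (d * RtoC z) -> wterm q c d z k <> 0.
Proof.
  intros hq hz hc hd. unfold wterm, ASC_weight.
  assert (P1 := qpoch_inf_neq_0 _ q hq (qregular_wterm q c z k hq hc)).
  assert (P2 := qpoch_inf_neq_0 _ q hq (qregular_wterm q d z k hq hd)).
  apply Cmult_neq_0.
  - intros E. apply C1_nz. rewrite <- (Cinv_r (qpoch_inf (c * RtoC (z * powerRZ q k)) q
      * qpoch_inf (d * RtoC (z * powerRZ q k)) q)).
    + rewrite E. ring.
    + now apply Cmult_neq_0.
  - apply RtoC_neq_0, Rmult_integral_contrapositive_currified; auto.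
    apply powerRZ_NOR. lra.
Qed.

Lemma wterm_nonneg_summable (q : R) (c d : C) (z : R) : (0 < q < 1)%R ->
  ~ in_qZ q (c * RtoC z) -> ~ in_qZ q (d * RtoC z) ->
  Cabs_summable (Znonneg_part (wterm q c d z)).
Proof.
  intros hq hc hd.
  apply Cabs_summable_ext with (fun n =>
    / qpoch_inf (c * RtoC z * RtoC q ^ n) q * / qpoch_inf (d * RtoC z * RtoC q ^ n) q
    * RtoC z * RtoC q ^ n).
  - intros n. unfold Znonneg_part. rewrite wterm_nat by auto. ring.
  - eapply Cabs_summable_le.
    + intros n. apply Cmod_Cmult_le; [apply Cmod_Cmult_le; [apply Cmod_Cmult_le|]|].
      * apply inv_qpoch_inf_bound; auto. now apply qregular_not_in_qZ.
      * apply inv_qpoch_inf_bound; auto. now apply qregular_not_in_qZ.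
      * apply Rle_refl.
      * rewrite Cmod_qpow by auto. apply Rle_refl.
    + apply (ex_series_scal (V := R_NormedModule)). now apply ex_series_qpow.
Qed.

Lemma Cmod_1_minus_div_qpow (q : R) (y : C) (m : nat) : (0 < q < 1)%R ->
  Cmod (1 - y / RtoC q ^ m) = (Cmod (RtoC q ^ m - y) / q ^ m)%R.
Proof.
  intros hq. assert (N : RtoC q ^ m <> 0) by (apply Cpow_nz, RtoC_neq_0; lra).
  rewrite <- (Cmod_qpow q m), <- Cmod_div by auto. f_equal. now field.
Qed.

(* The ratio of consecutive terms at [z q^-n] is of the order of [q^(2n)]. *)
Lemma wterm_neg_summable (q : R) (c d : C) (z : R) : (0 < q < 1)%R ->
  z <> 0%R -> c <> 0 -> d <> 0 ->
  ~ in_qZ q (c * RtoC z) -> ~ in_qZ q (d * RtoC z) ->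
  Cabs_summable (Zneg_part (wterm q c d z)).
Proof.
  intros hq hz c0 d0 hc hd.
  set (a := fun n => Cmod (Zneg_part (wterm q c d z) n)).
  assert (Ha : forall n, (0 < a n)%R).
  { intros n. apply Cmod_gt_0. now apply wterm_neq_0. }
  assert (Hr : forall n, (a (S n) / a n = q ^ S (S n) * q ^ S (S n)
    * / (q * (Cmod (RtoC q ^ S (S n) - c * RtoC z) * Cmod (RtoC q ^ S (S n) - d * RtoC z))))%R).
  { intros n. assert (E := f_equal Cmod (wterm_pred q c d z n hq hc hd)).
    fold (a n) in E. rewrite !Cmod_mult in E. fold (a (S n)) in E.
    rewrite !Cmod_1_minus_div_qpow, Cmod_R, Rabs_pos_eq in E by lra.
    assert (Hn := Ha n). assert (HSn := Ha (S n)).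
    assert (Hq : (q ^ S (S n) <> 0)%R) by (apply pow_nonzero; lra).
    (* Neither factor can vanish, because their product with other quantities is the positive number
       [a n]. *)
    assert (P : forall y z' : R, (a n = y / q ^ S (S n) * (z' / q ^ S (S n)) * q * a (S n))%R ->
                 y <> 0%R /\ z' <> 0%R).
    { intros y z' Ey. split; intros ->; unfold Rdiv in Ey; lra. }
    destruct (P _ _ E). rewrite E. field. repeat split; auto; lra. }
  assert (Hs : ex_series (fun n => Rabs (a n))).
  { apply ex_series_DAlembert with 0%R.
    - lra.
    - intros n. assert (T := Ha n). lra.
    - apply (proj1 (is_lim_seq_abs_0 _)).
      apply is_lim_seq_ext with (1 := fun n => eq_sym (Hr n)).
      assert (Hq : is_lim_seq (fun n => q ^ S (S n))%R 0%R).
      { apply is_lim_seq_ext with (fun n => q ^ (n + 2))%R; [intros n; f_equal; lia|].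
        apply (is_lim_seq_incr_n (fun n => q ^ n)%R 2 0%R). now apply is_lim_seq_qpow. }
      assert (Hc : forall y : C, is_lim_seq (fun n => Cmod (RtoC q ^ S (S n) - y)) (Cmod y)).
      { intros y. replace (Cmod y) with (Cmod (0 - y))
          by (rewrite <- (Cmod_opp y); f_equal; ring).
        apply Clim_Cmod, Clim_minus; [|apply Clim_const].
        apply (Clim_subseq (fun n => RtoC q ^ n) 0 (fun n => S (S n))); [lia|now apply Clim_qpow]. }
      (* The limit of the denominator of the ratio, positive because q, c, d and z are nonzero; the
         numerator tends to 0. *)
      set (l := (q * (Cmod (c * RtoC z) * Cmod (d * RtoC z)))%R).
      replace (Finite 0) with (Finite (0 * 0 * / l)) by (f_equal; ring).
      apply is_lim_seq_mult'; [now apply is_lim_seq_mult'|].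
      apply (is_lim_seq_inv _ (Finite l)).
      + apply is_lim_seq_mult'; [apply is_lim_seq_const|].
        apply is_lim_seq_mult'; apply Hc.
      + intros E. injection E as E. revert E.
        assert (hz' : RtoC z <> 0) by now apply RtoC_neq_0.
        assert (0 < l)%R; [|lra].
        apply Rmult_lt_0_compat; [lra|].
        apply Rmult_lt_0_compat; apply Cmod_gt_0; now apply Cmult_neq_0. }
  apply ex_series_ext with (2 := Hs). intros n. apply Rabs_pos_eq, Cmod_ge_0.
Qed.

Lemma wterm_summable (q : R) (c d : C) (z : R) : (0 < q < 1)%R ->
  z <> 0%R -> c <> 0 -> d <> 0 ->
  ~ in_qZ q (c * RtoC z) -> ~ in_qZ q (d * RtoC z) ->
  Zabs_summable (wterm q c d z).
Proof.
  intros. split; [now apply wterm_nonneg_summable|now apply wterm_neg_summable].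
Qed.

(** * The total mass *)

Lemma qpow_neq_0 (q : R) (n : nat) : (0 < q < 1)%R -> RtoC q ^ n <> 0.
Proof. intros hq. apply Cpow_nz, RtoC_neq_0. lra. Qed.

Lemma Cdiv_neq_0 (x y : C) : x <> 0 -> y <> 0 -> x / y <> 0.
Proof.
  intros hx hy E. apply hx. replace x with (x / y * y) by (field; auto).
  rewrite E. ring.
Qed.

(** Scaling z and both end points by q^-M leaves their ratios unchanged. The numerator therefore
    depends on [n] alone and acts as the cutoff [chi] of [Zsum_cutoff_lim], while the weight is read
    at index n - M. *)
Lemma jterm_wterm (q : R) (c d : C) (zp zm z : R) (M n : nat) : (0 < q < 1)%R ->
  zp <> 0%R -> zm <> 0%R ->
  ~ in_qZ q (c * RtoC z) -> ~ in_qZ q (d * RtoC z) ->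
  qpoch_inf (RtoC z / RtoC zp * RtoC q * RtoC q ^ n) q
  * qpoch_inf (RtoC z / RtoC zm * RtoC q * RtoC q ^ n) q
  * wterm q c d z (Z.of_nat n - Z.of_nat M)
  = jterm q (RtoC zp / RtoC q ^ M) (RtoC zm / RtoC q ^ M) c d (RtoC z / RtoC q ^ M) n.
Proof.
  intros hq hp hm hc hd. unfold wterm.
  rewrite ASC_weight_factor by (apply qpoch_inf_neq_0; auto; now apply qregular_wterm).
  unfold jterm.
  assert (N := qpow_neq_0 q M hq). apply RtoC_neq_0 in hp, hm.
  assert (Ex : RtoC (z * powerRZ q (Z.of_nat n - Z.of_nat M))
               = RtoC z / RtoC q ^ M * RtoC q ^ n).
  { rewrite RtoC_mult, powerRZ_sub_nat, <- pow_powerRZ, RtoC_pow by auto. now field. }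
  rewrite Ex.
  replace (RtoC z / RtoC q ^ M * RtoC q ^ n * RtoC q / (RtoC zp / RtoC q ^ M))
    with (RtoC z / RtoC zp * RtoC q * RtoC q ^ n) by (field; auto).
  replace (RtoC z / RtoC q ^ M * RtoC q ^ n * RtoC q / (RtoC zm / RtoC q ^ M))
    with (RtoC z / RtoC zm * RtoC q * RtoC q ^ n) by (field; auto).
  ring.
Qed.

Lemma jseries_wterm_lim (q : R) (c d : C) (zp zm z : R) : (0 < q < 1)%R ->
  zp <> 0%R -> zm <> 0%R -> z <> 0%R -> c <> 0 -> d <> 0 ->
  ~ in_qZ q (c * RtoC z) -> ~ in_qZ q (d * RtoC z) ->
  Clim (fun M => CSeries (jterm q (RtoC zp / RtoC q ^ M) (RtoC zm / RtoC q ^ M) c d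
                            (RtoC z / RtoC q ^ M)))
       (Zsum (wterm q c d z)).
Proof.
  intros hq hp hm hz c0 d0 hc hd.
  eapply Clim_ext.
  { intros M. apply CSeries_ext. intros n. apply jterm_wterm; auto. }
  eapply (Zsum_cutoff_lim (wterm q c d z) (fun n =>
    qpoch_inf (RtoC z / RtoC zp * RtoC q * RtoC q ^ n) q
    * qpoch_inf (RtoC z / RtoC zm * RtoC q * RtoC q ^ n) q)).
  - now apply wterm_summable.
  - intros n. apply Cmod_Cmult_le; now apply qpoch_inf_qpow_bound.
  - replace (RtoC 1) with (1 * 1) by ring.
    apply Clim_mult; now apply qpoch_inf_qpow_lim.
Qed.

Lemma qregular_neg (q r : R) : (0 < q < 1)%R -> (r < 0)%R -> qregular q (RtoC r).
Proof.
  intros hq hr n. rewrite <- RtoC_pow, <- RtoC_mult, <- RtoC_minus.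
  apply RtoC_neq_0. assert (0 < q ^ n)%R by (apply pow_lt; lra). nra.
Qed.

Lemma qregular_div_qpow (q : R) (y : C) (n : nat) : (0 < q < 1)%R ->
  ~ in_qZ q y -> qregular q (y / RtoC q ^ n).
Proof.
  intros hq H. assert (T := qregular_powerRZ q y (0 - Z.of_nat n) hq H).
  rewrite powerRZ_sub_nat in T by auto. simpl powerRZ in T.
  replace (y / RtoC q ^ n) with (y * (1 / RtoC q ^ n)); auto.
  field. now apply qpow_neq_0.
Qed.

Lemma qpoch_div_S (x : C) (q : R) (n : nat) : (0 < q < 1)%R ->
  qpoch (x / RtoC q ^ S n) q (S n)
  = (1 - x / RtoC q ^ S n) * qpoch (x / RtoC q ^ n) q n.
Proof.
  intros hq. rewrite qpoch_Sl.
  replace (x / RtoC q ^ S n * RtoC q) with (x / RtoC q ^ n); [reflexivity|].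
  rewrite Cpow_S. field. split; [now apply qpow_neq_0|apply RtoC_neq_0; lra].
Qed.

Lemma qpoch_inf_div (x : C) (q : R) (n : nat) : (0 < q < 1)%R ->
  qpoch_inf (x / RtoC q ^ n) q = qpoch (x / RtoC q ^ n) q n * qpoch_inf x q.
Proof.
  intros hq. rewrite (qpoch_inf_split _ q n) by auto.
  replace (x / RtoC q ^ n * RtoC q ^ n) with x; [reflexivity|].
  field. now apply qpow_neq_0.
Qed.

(* The finite reversal [(x q^-n; q)_n = (-x)^n q^(-n(n+1)/2) (q/x; q)_n], with the
   prefactors of numerator and denominator cancelled against each other. *)
Lemma qpoch_reversal (q : R) (c d u v : C) (n : nat) : (0 < q < 1)%R ->
  c <> 0 -> d <> 0 -> u <> 0 -> v <> 0 ->
  qpoch (c * d * u * v / RtoC q ^ (n + n)) q (n + n)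
  * (qpoch (RtoC q / (c * u)) q n * qpoch (RtoC q / (c * v)) q n
     * (qpoch (RtoC q / (d * u)) q n * qpoch (RtoC q / (d * v)) q n))
  = RtoC q ^ n * qpoch (RtoC q / (c * d * u * v)) q (n + n)
  * (qpoch (c * u / RtoC q ^ n) q n * qpoch (c * v / RtoC q ^ n) q n
     * (qpoch (d * u / RtoC q ^ n) q n * qpoch (d * v / RtoC q ^ n) q n)).
Proof.
  intros hq c0 d0 u0 v0. induction n as [|n IH].
  - simpl. ring.
  - replace (S n + S n)%nat with (S (S (n + n))) by lia.
    rewrite !qpoch_div_S by auto.
    rewrite (qpoch_S _ _ n), (qpoch_S _ _ n), (qpoch_S _ _ n), (qpoch_S _ _ n).
    rewrite (qpoch_S (RtoC q / (c * d * u * v))), (qpoch_S (RtoC q / (c * d * u * v))).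
    match type of IH with
      ?w2 * (?a1 * ?a2 * (?a3 * ?a4)) = _ * ?w1 * (?b1 * ?b2 * (?b3 * ?b4)) =>
      set (W2 := w2) in *; set (A1 := a1) in *; set (A2 := a2) in *;
      set (A3 := a3) in *; set (A4 := a4) in *; set (W1 := w1) in *;
      set (B1 := b1) in *; set (B2 := b2) in *; set (B3 := b3) in *; set (B4 := b4) in *
    end.
    rewrite !Cpow_S, !Cpow_add_r.
    assert (N := qpow_neq_0 q n hq).
    assert (N0 : RtoC q <> 0) by (apply RtoC_neq_0; lra).
    set (Q := RtoC q) in *. set (P := Q ^ n) in *.
    (* The factors new at n + 1 are split from the old products so that the induction hypothesis
       applies; the rest follows from 1 - x q^-m = -x q^-m (1 - q^m/x), up to the one extra factor
       q. *)
    match goal with |- ?L = ?R =>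
      transitivity (W2 * (A1 * A2 * (A3 * A4)) *
        ((1 - c * d * u * v / (Q * (Q * (P * P)))) * (1 - c * d * u * v / (Q * (P * P)))
         * ((1 - Q / (c * u) * P) * (1 - Q / (c * v) * P)
            * ((1 - Q / (d * u) * P) * (1 - Q / (d * v) * P)))));
      [ring|rewrite IH] end.
    field. repeat split; auto.
Qed.

(** Arranged for M -> oo: the only factors depending on M are J and finite products that converge to
    the second halves of the theta functions. The q^M left by [qpoch_reversal] has cancelled the
    q^-M in the end point. *)
Lemma jint_value (q : R) (c d : C) (zp zm : R) (M : nat) :
  (0 < q < 1)%R -> (zm < 0)%R -> (0 < zp)%R -> c <> 0 -> d <> 0 ->
  ~ in_qZ q (c * RtoC zm) -> ~ in_qZ q (c * RtoC zp) ->
  ~ in_qZ q (d * RtoC zm) -> ~ in_qZ q (d * RtoC zp) ->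
  (qpoch_inf (c * RtoC zp) q * qpoch_inf (c * RtoC zm) q
   * (qpoch_inf (d * RtoC zp) q * qpoch_inf (d * RtoC zm) q))
  * (qpoch (RtoC q / (c * RtoC zp)) q M * qpoch (RtoC q / (c * RtoC zm)) q M
     * (qpoch (RtoC q / (d * RtoC zp)) q M * qpoch (RtoC q / (d * RtoC zm)) q M))
  * jint q (RtoC zp / RtoC q ^ M) (RtoC zm / RtoC q ^ M) c d
  = qpoch_inf (c * d * RtoC zp * RtoC zm) q
    * qpoch (RtoC q / (c * d * RtoC zp * RtoC zm)) q (M + M)
    * (RtoC zp * (qpoch_inf (RtoC q) q * theta (RtoC zm / RtoC zp) q)).
Proof.
  intros hq hm hp c0 d0 hcm hcp hdm hdp.
  assert (N := qpow_neq_0 q M hq).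
  assert (p0 : RtoC zp <> 0) by (apply RtoC_neq_0; lra).
  assert (m0 : RtoC zm <> 0) by (apply RtoC_neq_0; lra).
  assert (za0 : RtoC zp / RtoC q ^ M <> 0) by now apply Cdiv_neq_0.
  assert (zb0 : RtoC zm / RtoC q ^ M <> 0) by now apply Cdiv_neq_0.
  assert (Hr : forall y : C, ~ in_qZ q (y * RtoC zm) -> ~ in_qZ q (y * RtoC zp) ->
    jregular q (RtoC zp / RtoC q ^ M) (RtoC zm / RtoC q ^ M) y).
  { intros y H1 H2. unfold Cdiv.
    split; rewrite Cmult_assoc; now apply qregular_div_qpow. }
  assert (E := jint_reduce_00 q _ _ c d hq za0 zb0 (Hr c hcm hcp) (Hr d hdm hdp)).
  rewrite jint_00 in E; auto.
  (* The ratio of the end points is free of M and negative, so no factor 1 - (q zb/za) q^n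
     vanishes. *)
  2: { replace (RtoC q / (RtoC zp / RtoC q ^ M) * (RtoC zm / RtoC q ^ M))
         with (RtoC (q / zp * zm)).
       - apply qregular_neg; auto.
         assert (0 < q / zp)%R by (apply Rdiv_lt_0_compat; lra). nra.
       - rewrite RtoC_mult, RtoC_div by lra. field. auto. }
  2: { replace (RtoC q / (RtoC zm / RtoC q ^ M) * (RtoC zp / RtoC q ^ M))
         with (RtoC (q / zm * zp)).
       - apply qregular_neg; auto. unfold Rdiv.
         assert (/ zm < 0)%R by (now apply Rinv_lt_0_compat). 
         assert (q * / zm < 0)%R by nra. nra.
       - rewrite RtoC_mult, RtoC_div by lra. field. auto. }
  replace (RtoC zm / RtoC q ^ M / (RtoC zp / RtoC q ^ M)) with (RtoC zm / RtoC zp) in E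
    by (field; auto).
  replace (c * d * (RtoC zp / RtoC q ^ M) * (RtoC zm / RtoC q ^ M))
    with (c * d * RtoC zp * RtoC zm / RtoC q ^ (M + M)) in E
    by (rewrite Cpow_add_r; field; auto).
  replace (c * (RtoC zp / RtoC q ^ M)) with (c * RtoC zp / RtoC q ^ M) in E by (unfold Cdiv; ring).
  replace (c * (RtoC zm / RtoC q ^ M)) with (c * RtoC zm / RtoC q ^ M) in E by (unfold Cdiv; ring).
  replace (d * (RtoC zp / RtoC q ^ M)) with (d * RtoC zp / RtoC q ^ M) in E by (unfold Cdiv; ring).
  replace (d * (RtoC zm / RtoC q ^ M)) with (d * RtoC zm / RtoC q ^ M) in E by (unfold Cdiv; ring).
  rewrite !qpoch_inf_div in E by auto.
  assert (K := qpoch_reversal q c d (RtoC zp) (RtoC zm) M hq c0 d0 p0 m0).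
  assert (P1 := qpoch_neq_0 _ _ M (qregular_div_qpow q _ M hq hcp)).
  assert (P2 := qpoch_neq_0 _ _ M (qregular_div_qpow q _ M hq hcm)).
  assert (P3 := qpoch_neq_0 _ _ M (qregular_div_qpow q _ M hq hdp)).
  assert (P4 := qpoch_neq_0 _ _ M (qregular_div_qpow q _ M hq hdm)).
  (* Naming every product turns the rest into algebra: [E] gives J, [K] exchanges reversed products,
     and the nonzero factors are cancelled. *)
  revert E K P1 P2 P3 P4.
  generalize (jint q (RtoC zp / RtoC q ^ M) (RtoC zm / RtoC q ^ M) c d)
    (qpoch_inf (c * RtoC zp) q) (qpoch_inf (c * RtoC zm) q)
    (qpoch_inf (d * RtoC zp) q) (qpoch_inf (d * RtoC zm) q)
    (qpoch (RtoC q / (c * RtoC zp)) q M) (qpoch (RtoC q / (c * RtoC zm)) q M)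
    (qpoch (RtoC q / (d * RtoC zp)) q M) (qpoch (RtoC q / (d * RtoC zm)) q M)
    (qpoch (c * RtoC zp / RtoC q ^ M) q M) (qpoch (c * RtoC zm / RtoC q ^ M) q M)
    (qpoch (d * RtoC zp / RtoC q ^ M) q M) (qpoch (d * RtoC zm / RtoC q ^ M) q M)
    (qpoch_inf (c * d * RtoC zp * RtoC zm) q)
    (qpoch (c * d * RtoC zp * RtoC zm / RtoC q ^ (M + M)) q (M + M))
    (qpoch (RtoC q / (c * d * RtoC zp * RtoC zm)) q (M + M))
    (qpoch_inf (RtoC q) q * theta (RtoC zm / RtoC zp) q).
  intros J i1 i2 i3 i4 r1 r2 r3 r4 f1 f2 f3 f4 W w2 w1 T E K P1 P2 P3 P4.
  assert (Hcancel : forall x y z : C, z <> 0 -> z * x = z * y -> x = y).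
  { intros x y z Hz H. replace x with (/ z * (z * x)) by (field; auto).
    rewrite H. field. auto. }
  apply (Hcancel _ _ (f1 * f2 * (f3 * f4))).
  { repeat apply Cmult_neq_0; auto. }
  transitivity ((r1 * r2 * (r3 * r4)) * (f1 * i1 * (f2 * i2) * (f3 * i3 * (f4 * i4)) * J));
    [ring|].
  rewrite E.
  transitivity (w2 * (r1 * r2 * (r3 * r4)) * W * (RtoC zp / RtoC q ^ M) * T); [ring|].
  rewrite K. field. auto.
Qed.

Lemma theta_neq_0 (x : C) (q : R) : (0 < q < 1)%R -> x <> 0 -> ~ in_qZ q x ->
  theta x q <> 0.
Proof.
  intros hq x0 H. unfold theta. apply Cmult_neq_0; apply qpoch_inf_neq_0; auto.
  - now apply qregular_not_in_qZ.
  - apply qregular_not_in_qZ; auto. intros [k Hk]. apply H. exists (- k + Z.of_nat 1)%Z.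
    assert (q0 : RtoC q <> 0) by (apply RtoC_neq_0; lra).
    rewrite powerRZ_add_nat, powerRZ_neg', RtoC_inv, <- Hk, Cpow_1_r
      by (auto; try lra; apply powerRZ_NOR; lra).
    field. auto.
Qed.

Lemma jackson_ASC_weight (q zm zp : R) (c d : C) :
  (0 < q < 1)%R -> (zm < 0)%R -> (0 < zp)%R -> c <> 0 -> d <> 0 ->
  ~ in_qZ q (c * RtoC zm) -> ~ in_qZ q (c * RtoC zp) ->
  ~ in_qZ q (d * RtoC zm) -> ~ in_qZ q (d * RtoC zp) ->
  jackson_integrable q zm zp (fun x => ASC_weight q c d (RtoC x)) /\
  jackson_int q zm zp (fun x => ASC_weight q c d (RtoC x)) = B q c d zm zp.
Proof.
  intros hq hm hp c0 d0 hcm hcp hdm hdp.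
  assert (p0 : zp <> 0%R) by lra. assert (m0 : zm <> 0%R) by lra.
  assert (Sp := wterm_summable q c d zp hq p0 c0 d0 hcp hdp).
  assert (Sm := wterm_summable q c d zm hq m0 c0 d0 hcm hdm).
  assert (Et : forall k, 1 * wterm q c d zp k + (-1) * wterm q c d zm k
    = jackson_term q zm zp (fun x => ASC_weight q c d (RtoC x)) k).
  { intros k. unfold jackson_term, wterm. ring. }
  split.
  - apply Zabs_summable_ext with (1 := Et). now apply Zabs_summable_lin.
  - unfold jackson_int. rewrite <- (Zsum_ext _ _ Et), Zsum_lin by auto.
    assert (L : Clim (fun M => jint q (RtoC zp / RtoC q ^ M) (RtoC zm / RtoC q ^ M) c d)
                  (Zsum (wterm q c d zp) - Zsum (wterm q c d zm))).
    { apply Clim_minus; now apply jseries_wterm_lim. }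
    assert (E : theta (c * RtoC zp) q * theta (c * RtoC zm) q
       * (theta (d * RtoC zp) q * theta (d * RtoC zm) q)
       * (Zsum (wterm q c d zp) - Zsum (wterm q c d zm))
       = theta (c * d * RtoC zp * RtoC zm) q
         * (RtoC zp * (qpoch_inf (RtoC q) q * theta (RtoC zm / RtoC zp) q))).
    (* Both sides are limits of the two sides of [jint_value], each theta being an M-independent
       factor times the limit of a finite product. *)
    { eapply Clim_unique.
      2: { eapply Clim_ext.
           { intros M. symmetry.
             exact (jint_value q c d zp zm M hq hm hp c0 d0 hcm hcp hdm hdp). }
           apply Clim_mult; [|apply Clim_const].
           apply Clim_mult; [apply Clim_const|].
           apply (Clim_subseq (qpoch (RtoC q / (c * d * RtoC zp * RtoC zm)) q) _
                    (fun M => (M + M)%nat)); [lia|now apply qpoch_inf_lim]. }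
      unfold theta.
      match goal with |- Clim _ (?a * ?a' * (?b * ?b') * (?e * ?e' * (?f * ?f')) * ?g) =>
        replace (a * a' * (b * b') * (e * e' * (f * f')) * g)
          with (a * b * (e * f) * (a' * b' * (e' * f')) * g) by ring end.
      apply Clim_mult; auto.
      apply Clim_mult; [apply Clim_const|].
      repeat apply Clim_mult; now apply qpoch_inf_lim. }
    apply RtoC_neq_0 in p0, m0.
    assert (T1 := theta_neq_0 _ q hq (Cmult_neq_0 _ _ c0 p0) hcp).
    assert (T2 := theta_neq_0 _ q hq (Cmult_neq_0 _ _ c0 m0) hcm).
    assert (T3 := theta_neq_0 _ q hq (Cmult_neq_0 _ _ d0 p0) hdp).
    assert (T4 := theta_neq_0 _ q hq (Cmult_neq_0 _ _ d0 m0) hdm).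
    unfold B. replace (c * d * RtoC zm * RtoC zp) with (c * d * RtoC zp * RtoC zm) by ring.
    replace (RtoC (1 - q) * RtoC zp * (qpoch_inf (RtoC q) q
      * (theta (RtoC zm / RtoC zp) q * theta (c * d * RtoC zp * RtoC zm) q)))
      with (RtoC (1 - q) * (theta (c * d * RtoC zp * RtoC zm) q
         * (RtoC zp * (qpoch_inf (RtoC q) q * theta (RtoC zm / RtoC zp) q)))) by ring.
    rewrite <- E. field. auto.
Qed.

(** * Orthogonality *)

(** Value and integrability travel together because [jackson_int] is total and is linear only on
    integrable functions. *)
Definition has_jackson_int (q zm zp : R) (f : R -> C) (I : C) : Prop :=
  jackson_integrable q zm zp f /\ jackson_int q zm zp f = I.

(** Agreement is asked only on the two lattices, since identities such as [ASC_weight_qpow] rely on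
    nonvanishing products, which the hypotheses guarantee only there. *)
Lemma has_jackson_int_ext (q zm zp : R) (f g : R -> C) (I : C) :
  (forall k, f (zp * powerRZ q k)%R = g (zp * powerRZ q k)%R) ->
  (forall k, f (zm * powerRZ q k)%R = g (zm * powerRZ q k)%R) ->
  has_jackson_int q zm zp f I -> has_jackson_int q zm zp g I.
Proof.
  intros Hp Hm [H1 H2].
  assert (E : forall k, jackson_term q zm zp f k = jackson_term q zm zp g k).
  { intros k. unfold jackson_term. now rewrite Hp, Hm. }
  split.
  - now apply Zabs_summable_ext with (1 := E).
  - rewrite <- H2. unfold jackson_int. now rewrite (Zsum_ext _ _ E).
Qed.

Lemma has_jackson_int_lin (q zm zp : R) (a b : C) (f g : R -> C) (I J : C) :
  has_jackson_int q zm zp f I -> has_jackson_int q zm zp g J ->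
  has_jackson_int q zm zp (fun x => a * f x + b * g x) (a * I + b * J).
Proof.
  intros [F1 F2] [G1 G2].
  assert (E : forall k, a * jackson_term q zm zp f k + b * jackson_term q zm zp g k
                = jackson_term q zm zp (fun x => a * f x + b * g x) k).
  { intros k. unfold jackson_term. ring. }
  split.
  - apply Zabs_summable_ext with (1 := E). now apply Zabs_summable_lin.
  - unfold jackson_int in *. rewrite <- (Zsum_ext _ _ E), Zsum_lin by auto.
    rewrite <- F2, <- G2. ring.
Qed.

Lemma has_jackson_int_sum (q zm zp : R) (a : nat -> C) (f : nat -> R -> C) (I : nat -> C)
  (n : nat) :
  (forall k, has_jackson_int q zm zp (f k) (I k)) ->
  has_jackson_int q zm zp (fun x => sum_n (fun k => a k * f k x) n)
    (sum_n (fun k => a k * I k) n).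
Proof.
  intros H. induction n as [|n IH].
  - rewrite Csum_O.
    (* The dummy zero term brings the base case into the binary form of [has_jackson_int_lin]. *)
    apply has_jackson_int_ext with (fun x => a 0%nat * f 0%nat x + 0 * f 0%nat x);
      [intros k; rewrite Csum_O; ring..|].
    replace (a 0%nat * I 0%nat) with (a 0%nat * I 0%nat + 0 * I 0%nat) by ring.
    now apply has_jackson_int_lin.
  - rewrite Csum_S.
    apply has_jackson_int_ext with (fun x =>
      1 * sum_n (fun k => a k * f k x) n + a (S n) * f (S n) x);
      [intros k; rewrite Csum_S; ring..|].
    rewrite <- (Cmult_1_l (sum_n (fun k => a k * I k) n)).
    now apply has_jackson_int_lin.
Qed.

(** * Mixed moments from the quasi-periodicity of theta *)

Lemma ASC_weight_qpow (q : R) (c d x : C) (k j : nat) : (0 < q < 1)%R ->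
  qregular q (c * x) -> qregular q (d * x) ->
  ASC_weight q (c * RtoC q ^ k) (d * RtoC q ^ j) x
  = qpoch (c * x) q k * qpoch (d * x) q j * ASC_weight q c d x.
Proof.
  intros hq hc hd. unfold ASC_weight.
  rewrite (qpoch_inf_split (c * x) q k), (qpoch_inf_split (d * x) q j) by auto.
  replace (c * x * RtoC q ^ k) with (c * RtoC q ^ k * x) by ring.
  replace (d * x * RtoC q ^ j) with (d * RtoC q ^ j * x) by ring.
  assert (P1 := qpoch_neq_0 _ _ k hc). assert (P2 := qpoch_neq_0 _ _ j hd).
  assert (P3 := qpoch_inf_neq_0 _ _ hq (qregular_mult_qpow q c x k hc)).
  assert (P4 := qpoch_inf_neq_0 _ _ hq (qregular_mult_qpow q d x j hd)).
  field. auto.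
Qed.

Definition tri (q : R) (n : nat) : C := RtoC q ^ (n * (n - 1) / 2).

Lemma tri_S (q : R) (n : nat) : tri q (S n) = tri q n * RtoC q ^ n.
Proof.
  unfold tri. rewrite <- Cpow_add_r. f_equal.
  destruct n as [|n]; [reflexivity|].
  replace (S (S n) * (S (S n) - 1))%nat with (S n * (S n - 1) + S n * 2)%nat by (simpl; lia).
  now rewrite Nat.div_add by lia.
Qed.

(** The origin of q^(-n^2) in the norm, from two factors q^(-n(n-1)/2) and one q^-n. *)
Lemma tri_sqr (q : R) (n : nat) : tri q n * tri q n * RtoC q ^ n = RtoC q ^ (n * n).
Proof.
  induction n as [|n IH].
  - unfold tri. simpl. ring.
  - rewrite tri_S. replace (S n * S n)%nat with (n * n + (n + S n))%nat by lia.
    rewrite !Cpow_add_r, <- IH. ring.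
Qed.

Lemma theta_qshift (x : C) (q : R) : (0 < q < 1)%R -> x <> 0 ->
  theta (x * RtoC q) q = - theta x q / x.
Proof.
  intros hq hx. unfold theta.
  assert (q0 : RtoC q <> 0) by (apply RtoC_neq_0; lra).
  replace (RtoC q / (x * RtoC q)) with (/ x) by (field; auto).
  rewrite (qpoch_inf_shift x), (qpoch_inf_shift (/ x)) by auto.
  replace (/ x * RtoC q) with (RtoC q / x) by (unfold Cdiv; ring).
  field. auto.
Qed.

Lemma B_comm (q : R) (c d : C) (zm zp : R) : B q c d zm zp = B q d c zm zp.
Proof.
  unfold B, Cdiv. rewrite (Cmult_comm c d).
  f_equal. f_equal. ring.
Qed.

(** One theta shifts in the numerator and two in the denominator: -1/(cd z_- z_+) divided by 1/(c^2
    z_- z_+) is -c/d. *)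
Lemma B_qshift (q : R) (c d : C) (zm zp : R) :
  (0 < q < 1)%R -> zm <> 0%R -> zp <> 0%R -> c <> 0 -> d <> 0 ->
  ~ in_qZ q (c * RtoC zm) -> ~ in_qZ q (c * RtoC zp) ->
  ~ in_qZ q (d * RtoC zm) -> ~ in_qZ q (d * RtoC zp) ->
  B q (c * RtoC q) d zm zp = - (c / d) * B q c d zm zp.
Proof.
  intros hq hm hp c0 d0 hcm hcp hdm hdp. apply RtoC_neq_0 in hm, hp.
  unfold B.
  assert (T1 := theta_neq_0 _ q hq (Cmult_neq_0 _ _ c0 hp) hcp).
  assert (T2 := theta_neq_0 _ q hq (Cmult_neq_0 _ _ c0 hm) hcm).
  assert (T3 := theta_neq_0 _ q hq (Cmult_neq_0 _ _ d0 hp) hdp).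
  assert (T4 := theta_neq_0 _ q hq (Cmult_neq_0 _ _ d0 hm) hdm).
  replace (c * RtoC q * d * RtoC zm * RtoC zp) with (c * d * RtoC zm * RtoC zp * RtoC q) by ring.
  replace (c * RtoC q * RtoC zm) with (c * RtoC zm * RtoC q) by ring.
  replace (c * RtoC q * RtoC zp) with (c * RtoC zp * RtoC q) by ring.
  rewrite !theta_qshift by (auto; repeat apply Cmult_neq_0; auto).
  field. repeat split; auto.
Qed.

Lemma B_qpow (q : R) (c d : C) (zm zp : R) (k : nat) :
  (0 < q < 1)%R -> zm <> 0%R -> zp <> 0%R -> c <> 0 -> d <> 0 ->
  ~ in_qZ q (c * RtoC zm) -> ~ in_qZ q (c * RtoC zp) ->
  ~ in_qZ q (d * RtoC zm) -> ~ in_qZ q (d * RtoC zp) ->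
  B q (c * RtoC q ^ k) d zm zp = (- (c / d)) ^ k * tri q k * B q c d zm zp.
Proof.
  intros hq hm hp c0 d0 hcm hcp hdm hdp.
  assert (N := qpow_neq_0 q).
  induction k as [|k IH].
  - unfold tri. simpl. rewrite (Cmult_1_r c). ring.
  - replace (c * RtoC q ^ S k) with (c * RtoC q ^ k * RtoC q) by (rewrite Cpow_S; ring).
    rewrite B_qshift, IH, tri_S, Cpow_S; auto.
    + field. auto.
    + apply Cmult_neq_0; auto.
    + replace (c * RtoC q ^ k * RtoC zm) with (c * RtoC zm * RtoC q ^ k) by ring.
      now apply in_qZ_mult_qpow.
    + replace (c * RtoC q ^ k * RtoC zp) with (c * RtoC zp * RtoC q ^ k) by ring.
      now apply in_qZ_mult_qpow.
Qed.

Lemma in_qZ_qpow_mult (q : R) (c z : C) (k : nat) : (0 < q < 1)%R ->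
  ~ in_qZ q (c * z) -> ~ in_qZ q (c * RtoC q ^ k * z).
Proof.
  intros hq H. replace (c * RtoC q ^ k * z) with (c * z * RtoC q ^ k) by ring.
  now apply in_qZ_mult_qpow.
Qed.

Lemma B_qpow2 (q : R) (c d : C) (zm zp : R) (k j : nat) :
  (0 < q < 1)%R -> zm <> 0%R -> zp <> 0%R -> c <> 0 -> d <> 0 ->
  ~ in_qZ q (c * RtoC zm) -> ~ in_qZ q (c * RtoC zp) ->
  ~ in_qZ q (d * RtoC zm) -> ~ in_qZ q (d * RtoC zp) ->
  B q (c * RtoC q ^ k) (d * RtoC q ^ j) zm zp
  = (- (d / c)) ^ j * tri q j * (- (c / d)) ^ k * tri q k
    * (/ RtoC q ^ j) ^ k * B q c d zm zp.
Proof.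
  intros hq hm hp c0 d0 hcm hcp hdm hdp.
  assert (N := fun n => qpow_neq_0 q n hq).
  (* The power of [d] is removed first, while [c] still carries q^k; the ratio d/(c q^k) raised to
     the power j yields the cross factor q^(-jk). *)
  rewrite B_comm, B_qpow; auto; try (now apply in_qZ_qpow_mult).
  2: { now apply Cmult_neq_0. }
  rewrite B_comm, B_qpow by auto.
  replace (- (d / (c * RtoC q ^ k))) with (- (d / c) * / RtoC q ^ k) by (field; auto).
  rewrite Cpow_mult_l, !Cpow_inv, <- !Cpow_mult_r, (Nat.mul_comm j k) by auto.
  ring.
Qed.

Lemma jackson_mixed_moment (q zm zp : R) (c d : C) (k j : nat) :
  (0 < q < 1)%R -> (zm < 0)%R -> (0 < zp)%R -> c <> 0 -> d <> 0 ->
  ~ in_qZ q (c * RtoC zm) -> ~ in_qZ q (c * RtoC zp) ->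
  ~ in_qZ q (d * RtoC zm) -> ~ in_qZ q (d * RtoC zp) ->
  has_jackson_int q zm zp
    (fun x => qpoch (c * RtoC x) q k * (qpoch (d * RtoC x) q j * ASC_weight q c d (RtoC x)))
    ((- (d / c)) ^ j * tri q j * (- (c / d)) ^ k * tri q k
     * (/ RtoC q ^ j) ^ k * B q c d zm zp).
Proof.
  intros hq hm hp c0 d0 hcm hcp hdm hdp.
  assert (N := fun n => qpow_neq_0 q n hq).
  rewrite <- B_qpow2 by (auto; lra).
  apply has_jackson_int_ext with
    (fun x => ASC_weight q (c * RtoC q ^ k) (d * RtoC q ^ j) (RtoC x)).
  - intros i. rewrite ASC_weight_qpow by (auto; now apply qregular_wterm). ring.
  - intros i. rewrite ASC_weight_qpow by (auto; now apply qregular_wterm). ring.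
  - apply jackson_ASC_weight; auto; try (now apply in_qZ_qpow_mult);
      now apply Cmult_neq_0.
Qed.

(** The q-Pascal rule, matching the factor 1 - y q^-(n+1) that is peeled off (y q^-(n+1); q)_(n+1)
    in [qbinomial]. *)
Lemma qbinomial_coef_rec (q : R) (n k : nat) : (0 < q < 1)%R ->
  qpoch (/ RtoC q ^ S n) q (S k) / qpoch (RtoC q) q (S k)
  = qpoch (/ RtoC q ^ n) q (S k) / qpoch (RtoC q) q (S k)
    - / RtoC q ^ S n * (qpoch (/ RtoC q ^ n) q k / qpoch (RtoC q) q k).
Proof.
  intros hq. assert (N := qpow_neq_0 q n hq).
  assert (q0 : RtoC q <> 0) by (apply RtoC_neq_0; lra).
  assert (Q1 := qregular_q q hq).
  assert (P := qpoch_neq_0 _ _ k Q1). assert (P1 := Q1 k).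
  rewrite (qpoch_Sl (/ RtoC q ^ S n)), (qpoch_S (/ RtoC q ^ n)), (qpoch_S (RtoC q)).
  replace (/ RtoC q ^ S n * RtoC q) with (/ RtoC q ^ n) by (rewrite Cpow_S; field; auto).
  rewrite Cpow_S. field. auto.
Qed.

Lemma qpoch_neg_eq_0 (q : R) (j n : nat) : (0 < q < 1)%R -> (j < n)%nat ->
  qpoch (/ RtoC q ^ j) q n = 0.
Proof.
  intros hq H. replace n with (S j + (n - S j))%nat by lia.
  rewrite qpoch_add, qpoch_S, Cinv_l by now apply qpow_neq_0. ring.
Qed.

Lemma qbinomial (q : R) (n : nat) (y : C) : (0 < q < 1)%R ->
  qpoch (y / RtoC q ^ n) q n
  = sum_n (fun k => qpoch (/ RtoC q ^ n) q k / qpoch (RtoC q) q k * y ^ k) n.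
Proof.
  intros hq. induction n as [|n IH].
  - rewrite Csum_O. simpl. field.
  - rewrite qpoch_div_S, IH by auto.
    (* The truncation order N is freed from n so that induction on it is possible. At N = n the
       first sum has one extra term, which vanishes because (q^-n; q)_(n+1) = 0. *)
    assert (E : forall N,
      sum_n (fun k => qpoch (/ RtoC q ^ n) q k / qpoch (RtoC q) q k * y ^ k) (S N)
      - y / RtoC q ^ S n
        * sum_n (fun k => qpoch (/ RtoC q ^ n) q k / qpoch (RtoC q) q k * y ^ k) N
      = sum_n (fun k => qpoch (/ RtoC q ^ S n) q k / qpoch (RtoC q) q k * y ^ k) (S N)).
    { intros N. induction N as [|N IHN].
      - rewrite !Csum_S, !Csum_O, qbinomial_coef_rec by auto. simpl. unfold Cdiv. ring.
      - rewrite (Csum_S _ (S N)), (Csum_S _ N), (Csum_S _ (S N)), <- IHN.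
        rewrite qbinomial_coef_rec by auto. rewrite (Csum_S _ N), (Cpow_S y (S N)).
        unfold Cdiv. ring. }
    rewrite <- E, Csum_S, qpoch_neg_eq_0 by (auto; lia).
    unfold Cdiv. ring.
Qed.

Lemma qpoch_neg_self (q : R) (n : nat) : (0 < q < 1)%R ->
  qpoch (/ RtoC q ^ n) q n = (- (1)) ^ n * qpoch (RtoC q) q n / (tri q n * RtoC q ^ n).
Proof.
  intros hq. assert (N := fun n => qpow_neq_0 q n hq).
  assert (T : forall n, tri q n <> 0) by (intros; apply N).
  assert (q0 : RtoC q <> 0) by (apply RtoC_neq_0; lra).
  induction n as [|n IH].
  - unfold tri. simpl. field.
  - replace (/ RtoC q ^ S n) with (1 / RtoC q ^ S n) by (unfold Cdiv; ring).
    rewrite qpoch_div_S by auto.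
    replace (1 / RtoC q ^ n) with (/ RtoC q ^ n) by (unfold Cdiv; ring).
    rewrite IH, tri_S, (qpoch_S (RtoC q)), !Cpow_S. field. auto.
Qed.

(** Orthogonality uses only the degree and the leading coefficient of the expansion, so the other
    coefficients stay existential. Vanishing above m lets sums be lengthened in the induction. *)
Lemma qpoch_expand (q : R) (c d : C) (m : nat) : (0 < q < 1)%R -> d <> 0 ->
  exists g : nat -> C,
    (forall x, qpoch (c * x) q m = sum_n (fun j => g j * qpoch (d * x) q j) m) /\
    (forall j, (m < j)%nat -> g j = 0) /\ g m = (c / d) ^ m.
Proof.
  intros hq d0. induction m as [|m (g & Hg & H0 & Hm)].
  - exists (fun j => match j with O => RtoC 1 | S _ => RtoC 0 end). repeat split.
    + intros x. rewrite Csum_O. simpl. ring.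
    + intros j Hj. destruct j; [lia|reflexivity].
  - assert (N := fun n => qpow_neq_0 q n hq).
    (* With r = (c/d) q^(m-j) one has 1 - c x q^m = (1 - r) + r (1 - d x q^j), so the new factor
       sends (dx)_j to (1 - r)(dx)_j + r (dx)_(j+1). *)
    exists (fun j => match j with
                     | O => RtoC 0
                     | S i => c / d * (RtoC q ^ m / RtoC q ^ i) * g i
                     end + (1 - c / d * (RtoC q ^ m / RtoC q ^ j)) * g j).
    repeat split.
    + intros x. rewrite qpoch_S, Hg.
      transitivity (sum_n (fun j => match j with
                     | O => RtoC 0
                     | S i => c / d * (RtoC q ^ m / RtoC q ^ i) * g i
                     end * qpoch (d * x) q j) (S m)
        + sum_n (fun j => (1 - c / d * (RtoC q ^ m / RtoC q ^ j)) * g j * qpoch (d * x) q j) (S m)).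
      * rewrite <- sum_n_Sl, (Csum_S _ m), (H0 (S m)) by lia.
        rewrite Cmult_0_l, Cplus_0_l, Cmult_0_r, Cmult_0_l, Cplus_0_r.
        rewrite <- sum_n_Cplus.
        rewrite Cmult_comm, <- sum_n_Cmult_l.
        apply Csum_ext. intros j. rewrite qpoch_S. field. auto.
      * rewrite <- sum_n_Cplus. apply Csum_ext. intros j. ring.
    + intros j Hj. destruct j; [lia|]. rewrite !H0 by lia. ring.
    + rewrite Hm, H0, (Cpow_S (c / d)) by lia.
      generalize ((c / d) ^ m). intros y. field. auto.
Qed.

Lemma qpoch_change_basis (q : R) (c d : C) (b : nat -> C) (m : nat) :
  (0 < q < 1)%R -> d <> 0 ->
  exists a : nat -> C,
    (forall x, sum_n (fun k => b k * qpoch (c * x) q k) m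
               = sum_n (fun j => a j * qpoch (d * x) q j) m) /\
    (forall j, (m < j)%nat -> a j = 0) /\ a m = b m * (c / d) ^ m.
Proof.
  intros hq d0. induction m as [|m (a & Ha & H0 & Hm)].
  - exists (fun j => match j with O => b 0%nat | S _ => RtoC 0 end). split; [|split].
    + intros x. now rewrite !Csum_O.
    + intros j Hj. destruct j; [lia|reflexivity].
    + simpl. ring.
  - destruct (qpoch_expand q c d (S m) hq d0) as (g & Hg & G0 & Gm).
    exists (fun j => a j + b (S m) * g j). repeat split.
    + intros x. rewrite Csum_S, Ha, Hg.
      transitivity (sum_n (fun j => a j * qpoch (d * x) q j) (S m)
        + b (S m) * sum_n (fun j => g j * qpoch (d * x) q j) (S m)).
      * rewrite (Csum_S (fun j => a j * qpoch (d * x) q j) m), (H0 (S m)) by lia.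
        rewrite Cmult_0_l, Cplus_0_r. reflexivity.
      * rewrite <- sum_n_Cmult_l, <- sum_n_Cplus. apply Csum_ext. intros j. ring.
    + intros j Hj. rewrite H0, G0 by lia. ring.
    + rewrite H0, Gm by lia. ring.
Qed.

Definition ASC_coef (q : R) (c d : C) (n k : nat) : C :=
  (- c) ^ n / tri q n * (qpoch (/ RtoC q ^ n) q k / qpoch (RtoC q) q k
    * (- (1)) ^ k / tri q k * (d * RtoC q ^ n / c) ^ k).

Lemma RtoC_inv_pow (q : R) (n : nat) : (0 < q < 1)%R -> RtoC (/ q ^ n) = / RtoC q ^ n.
Proof. intros hq. rewrite RtoC_inv, RtoC_pow by (apply pow_nonzero; lra). reflexivity. Qed.

Lemma ASC_P_coef (q : R) (c d : C) (n : nat) (x : C) : (0 < q < 1)%R ->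
  ASC_P q c d n x = sum_n (fun k => ASC_coef q c d n k * qpoch (c * x) q k) n.
Proof.
  intros hq. unfold ASC_P. rewrite <- sum_n_Cmult_l. apply Csum_ext. intros k.
  rewrite !RtoC_inv_pow, RtoC_pow by auto. unfold ASC_coef, tri, Cdiv. ring.
Qed.

(** The factors of the mixed moment that depend on k cancel [tri q k] and (d/c)^k in the coefficient
    of P_n, leaving the q-binomial series at y = q^(n-j), whose sum is (y q^-n; q)_n = (q^-j;
    q)_n. *)
Lemma jackson_ASC_P_qpoch (q zm zp : R) (c d : C) (n j : nat) :
  (0 < q < 1)%R -> (zm < 0)%R -> (0 < zp)%R -> c <> 0 -> d <> 0 ->
  ~ in_qZ q (c * RtoC zm) -> ~ in_qZ q (c * RtoC zp) ->
  ~ in_qZ q (d * RtoC zm) -> ~ in_qZ q (d * RtoC zp) ->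
  has_jackson_int q zm zp
    (fun x => qpoch (d * RtoC x) q j * (ASC_P q c d n (RtoC x) * ASC_weight q c d (RtoC x)))
    ((- c) ^ n / tri q n * ((- (d / c)) ^ j * tri q j) * B q c d zm zp
     * qpoch (/ RtoC q ^ j) q n).
Proof.
  intros hq hm hp c0 d0 hcm hcp hdm hdp.
  assert (N := fun n => qpow_neq_0 q n hq).
  assert (T : forall n, tri q n <> 0) by (intros; apply N).
  assert (H := has_jackson_int_sum q zm zp (ASC_coef q c d n)
    (fun k x => qpoch (c * RtoC x) q k * (qpoch (d * RtoC x) q j * ASC_weight q c d (RtoC x)))
    _ n (fun k => jackson_mixed_moment q zm zp c d k j hq hm hp c0 d0 hcm hcp hdm hdp)).
  replace (sum_n _ n) with ((- c) ^ n / tri q n * ((- (d / c)) ^ j * tri q j)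
    * B q c d zm zp * qpoch (/ RtoC q ^ j) q n) in H.
  - eapply has_jackson_int_ext; [| |exact H]; intros i; simpl;
      rewrite ASC_P_coef by auto;
      match goal with |- _ = ?a * (?s * ?w) =>
        replace (a * (s * w)) with (a * w * s) by ring end;
      rewrite <- sum_n_Cmult_l; apply Csum_ext; intros k; ring.
  - replace (/ RtoC q ^ j) with (RtoC q ^ n / RtoC q ^ j / RtoC q ^ n) at 1 by (field; auto).
    rewrite qbinomial, <- sum_n_Cmult_l by auto.
    apply Csum_ext. intros k. unfold ASC_coef.
    replace (RtoC q ^ n / RtoC q ^ j)
      with (- (1) * (d * RtoC q ^ n / c) * (- (c / d)) * / RtoC q ^ j) by (field; auto).
    rewrite !Cpow_mult_l. field. repeat split; auto.
    apply qpoch_neq_0. now apply qregular_q.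
Qed.

(** The leading coefficient of P_n in the basis (dx)_j: reversing (q^-n; q)_n cancels (q; q)_n and
    leaves powers that [tri_sqr] balances against q^(n^2). *)
Lemma ASC_coef_top (q : R) (c d : C) (n : nat) : (0 < q < 1)%R -> c <> 0 -> d <> 0 ->
  ASC_coef q c d n n * (c / d) ^ n = (- c) ^ n / tri q n.
Proof.
  intros hq c0 d0. unfold ASC_coef.
  assert (N := fun n => qpow_neq_0 q n hq).
  assert (T : forall n, tri q n <> 0) by (intros; apply N).
  assert (P := qpoch_neq_0 _ _ n (qregular_q q hq)).
  assert (E : (- (1)) ^ n * (- (1)) ^ n * (d * RtoC q ^ n / c) ^ n * (c / d) ^ n
              = tri q n * tri q n * RtoC q ^ n).
  { rewrite tri_sqr, Cpow_mult_r, <- !Cpow_mult_l. f_equal. field. auto. }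
  rewrite qpoch_neg_self by auto.
  transitivity ((- c) ^ n / tri q n *
    ((- (1)) ^ n * (- (1)) ^ n * (d * RtoC q ^ n / c) ^ n * (c / d) ^ n)
    / (tri q n * tri q n * RtoC q ^ n)).
  - field. auto.
  - rewrite E. field. auto.
Qed.

Lemma ASC_orthogonality_le (q zm zp : R) (c d : C) (m n : nat) :
  (0 < q < 1)%R -> (zm < 0)%R -> (0 < zp)%R -> c <> 0 -> d <> 0 ->
  ~ in_qZ q (c * RtoC zm) -> ~ in_qZ q (c * RtoC zp) ->
  ~ in_qZ q (d * RtoC zm) -> ~ in_qZ q (d * RtoC zp) -> (m <= n)%nat ->
  has_jackson_int q zm zp
    (fun x => ASC_P q c d m (RtoC x) * ASC_P q c d n (RtoC x) * ASC_weight q c d (RtoC x))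
    (delta m n * B q c d zm zp * qpoch (RtoC q) q n * Cpow (c * d) n
     * RtoC (/ q ^ (n * n))).
Proof.
  intros hq hm hp c0 d0 hcm hcp hdm hdp Hmn.
  assert (N := fun n => qpow_neq_0 q n hq).
  assert (T : forall n, tri q n <> 0) by (intros; apply N).
  destruct (qpoch_change_basis q c d (ASC_coef q c d m) m hq d0) as (a & Ha & _ & Ham).
  rewrite ASC_coef_top in Ham by auto.
  assert (H := has_jackson_int_sum q zm zp a
    (fun j x => qpoch (d * RtoC x) q j
                * (ASC_P q c d n (RtoC x) * ASC_weight q c d (RtoC x)))
    _ m (fun j => jackson_ASC_P_qpoch q zm zp c d n j hq hm hp c0 d0 hcm hcp hdm hdp)).
  set (I := fun j => a j * ((- c) ^ n / tri q n * ((- (d / c)) ^ j * tri q j)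
              * B q c d zm zp * qpoch (/ RtoC q ^ j) q n)) in H.
  (* Since m <= n, every index j of the expansion other than j = m = n falls in the range where
     (q^-j; q)_n = 0. *)
  assert (Hlow : forall M, (M < n)%nat -> RtoC 0 = sum_n I M).
  { intros M HM. induction M as [|M IH].
    - rewrite Csum_O. unfold I. rewrite qpoch_neg_eq_0 by auto. ring.
    - rewrite Csum_S, <- IH by lia. unfold I. rewrite qpoch_neg_eq_0 by auto. ring. }
  replace (sum_n I m) with (delta m n * B q c d zm zp * qpoch (RtoC q) q n
    * Cpow (c * d) n * RtoC (/ q ^ (n * n))) in H.
  - eapply has_jackson_int_ext; [| |exact H]; intros i; simpl;
      rewrite (ASC_P_coef q c d m), Ha by auto;
      match goal with |- _ = ?s * ?p * ?w =>
        replace (s * p * w) with (p * w * s) by ring end;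
      rewrite <- sum_n_Cmult_l; apply Csum_ext; intros j; ring.
  - unfold delta. destruct (Nat.eq_dec m n) as [->|Hne].
    + transitivity (I n).
      * unfold I. rewrite Ham, qpoch_neg_self, RtoC_inv_pow, <- tri_sqr by auto.
        (* The four n-th powers come from the leading coefficient of P_m, the prefactor of P_n, the
           moment in [d], and the sign of (q^-n; q)_n. *)
        assert (E : (c * d) ^ n = (- c) ^ n * (- c) ^ n * (- (d / c)) ^ n * (- (1)) ^ n).
        { rewrite <- !Cpow_mult_l. f_equal. field. auto. }
        rewrite E. field. auto.
      * destruct n as [|n]; [now rewrite Csum_O|].
        rewrite Csum_S, <- Hlow by lia. ring.
    + rewrite <- Hlow by lia. ring.
Qed.

Theorem theorem1p1 (q zm zp : R) (c d : C)
  (hq : (0 < q < 1)%R) (hzm : (zm < 0)%R) (hzp : (0 < zp)%R)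
  (hc : c <> 0) (hd : d <> 0)
  (hczm : ~ in_qZ q (c * RtoC zm)) (hczp : ~ in_qZ q (c * RtoC zp))
  (hdzm : ~ in_qZ q (d * RtoC zm)) (hdzp : ~ in_qZ q (d * RtoC zp))
  (n m : nat) :
  let f := fun x : R =>
    ASC_P q c d m (RtoC x) * ASC_P q c d n (RtoC x) * ASC_weight q c d (RtoC x) in
  jackson_integrable q zm zp f /\
  jackson_int q zm zp f =
    delta m n * B q c d zm zp * qpoch (RtoC q) q n
    * Cpow (c * d) n * RtoC (/ q ^ (n * n)).
Proof.
  intros f. destruct (Nat.le_ge_cases m n) as [H|H].
  - now apply ASC_orthogonality_le.
  - destruct (Nat.eq_dec m n) as [<-|Hne]; [now apply ASC_orthogonality_le|].
    (* For m > n the roles of m and n are exchanged; the two right-hand sides have different norms,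
       but both are multiplied by a vanishing delta. *)
    assert (R := ASC_orthogonality_le q zm zp c d n m hq hzm hzp hc hd
                   hczm hczp hdzm hdzp H).
    assert (D : forall i j, i <> j -> delta i j = 0).
    { intros i j Hij. unfold delta. now destruct (Nat.eq_dec i j). }
    rewrite D in R by auto. rewrite D by auto.
    rewrite !Cmult_0_l in *.
    apply has_jackson_int_ext with (3 := R); intros i; unfold f; ring.
Qed.
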